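(* Let $G$ be an affine algebraic supergroup over $\mathbb{C}$ acting on an affine supervariety $X$ over $\mathbb{C}$, and let $u\in|X|$ be a topological point of $X$, i.e. $u\in X(\mathbb{C})=\mathrm{Hom}(\mathbb{C}[X],\mathbb{C})$. Then the stabilizer supergroup functor $\mathrm{Stab}_u$ is (representable by) an affine supergroup.
   Context: Superalgebras are unital associative $\mathbb{Z}/2$-graded $\mathbb{C}$-algebras $A=A_0\oplus A_1$, commutative in the sense $xy=(-1)^{p(x)p(y)}yx$ for homogeneous $x,y$; ideals are homogeneous. An affine (algebraic) supervariety $X$ is given by its coordinate superalgebra $\mathbb{C}[X]$ such that $\mathbb{C}[X]/I^{odd}$ ($I^{odd}$ the ideal generated by the odd elements) is the coordinate ring of an ordinary affine algebraic variety and $\mathbb{C}[X]_1$ is a finitely generated $\mathbb{C}[X]_0$-module; its underlying space is $|X|=\mathrm{Spec}\,\mathbb{C}[X]_0$. Its functor of points, on commutative superalgebras with values in sets, is $X(A)=\mathrm{Hom}(\mathbb{C}[X],A)$. An affine supergroup is an affine supervariety $G$ whose functor of points is group valued; equivalently $\mathbb{C}[G]$ is a Hopf superalgebra. A group-valued functor on commutative superalgebras is called a supergroup functor. An action of $G$ on $X$ is a morphism of supervarieties $\rho:G\times X\to X$, $(g,x)\mapsto g\cdot x$ for $g\in G(A)$, $x\in X(A)$, satisfying the usual group action axioms. Since $\mathbb{C}\subset A$ for every superalgebra $A$, $u$ can be regarded as a point $u_A\in X(A)$. The stabilizer supergroup functor of $u$ is $$\mathrm{Stab}_u(A)=\{g\in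 G(A)\mid g\cdot u_A=u_A\}$$ for every commutative superalgebra $A$. *)

(* Defs.v *)
From HB Require Import structures.
From mathcomp Require Import all_boot all_order all_algebra.
From mathcomp Require Import boolp reals.
From mathcomp.real_closed Require Export complex.
From mathcomp Require Export reals.

Set Implicit Arguments.
Unset Strict Implicit.
Unset Printing Implicit Defensive.

Import GRing.Theory.
Local Open Scope ring_scope.

Reserved Notation "g \oS f" (at level 50, left associativity).
Reserved Notation "{ 'superhom' A -> B }"
  (A at level 98, B at level 99, format "{ 'superhom'  A  ->  B }").

(* The parities are indexed by bool: [homog false] is A_0, [homog true] is A_1.
   As every algType, a superalgebra is nonzero, so it contains the field K. *)
HB.mixin Record isSuperAlgebra (K : fieldType) A of GRing.Algebra K A := {
  homog : bool -> {pred A};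
  homog_submod : forall i, submod_closed (homog i);
  homog_disjoint : forall x, x \in homog false -> x \in homog true -> x = 0;
  homog_split : forall x, exists x0 x1,
    [/\ x0 \in homog false, x1 \in homog true & x = x0 + x1];
  homog1 : 1 \in homog false;
  homogM : forall i j x y,
    x \in homog i -> y \in homog j -> x * y \in homog (i (+) j);
  supercomm : forall i j x y, x \in homog i -> y \in homog j ->
    x * y = (-1) ^+ (i && j) * (y * x)
}.

#[short(type="superAlgType")]
HB.structure Definition SuperAlgebra (K : fieldType) :=
  {A of isSuperAlgebra K A & GRing.Algebra K A}.

Section SuperHom.
Variable K : fieldType.
Implicit Types A B C D : superAlgType K.

Record superhom A B := SuperHom {
  superhom_fun :> {lrmorphism A -> B};
  superhom_homog : forall i x,
    x \in @homog K A i -> superhom_fun x \in @homog K B i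
}.

HB.instance Definition _ A B := gen_eqMixin (superhom A B).
HB.instance Definition _ A B := gen_choiceMixin (superhom A B).

Lemma superhomP A B (f g : superhom A B) : f =1 g -> f = g.
Proof.
case: f => [[f cf] hf]; case: g => [[g cg] hg] /= /funext efg.
case: _ / efg in cg hg *.
have ecl : cf = cg.
  case: cf {hf} => [[a] [b] [c]]; case: cg {hg} => [[a'] [b'] [c']].
  by rewrite (Prop_irrelevance a a') (Prop_irrelevance b b')
             (Prop_irrelevance c c').
case: _ / ecl in hg *.
by rewrite (Prop_irrelevance hf hg).
Qed.

Fact superhom_id_subproof A i (x : A) :
  x \in homog i -> (idfun : {lrmorphism A -> A}) x \in homog i.
Proof. by []. Qed.
Definition superhom_id A : superhom A A := SuperHom (@superhom_id_subproof A).

Fact superhom_comp_subproof A B C (g : superhom B C) (f : superhom A B) i x :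
  x \in homog i -> (g \o f : {lrmorphism A -> C}) x \in homog i.
Proof. by move=> hx; do 2!apply: superhom_homog. Qed.
Definition superhom_comp A B C (g : superhom B C) (f : superhom A B) :
  superhom A C := SuperHom (superhom_comp_subproof g f).

Local Notation "g \oS f" := (superhom_comp g f).

Lemma superhom_compA A B C D
    (h : superhom C D) (g : superhom B C) (f : superhom A B) :
  h \oS (g \oS f) = (h \oS g) \oS f.
Proof. exact: superhomP. Qed.

Lemma superhom_comp1f A B (f : superhom A B) : superhom_id B \oS f = f.
Proof. exact: superhomP. Qed.

End SuperHom.

Notation "g \oS f" := (superhom_comp g f) : ring_scope.
Notation "{ 'superhom' A -> B }" := (superhom A B) : type_scope.

Section GroundField.
Variable K : fieldType.

(* K^o is K seen as an algebra over itself; it is purely even. *)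
Definition ground_homog (i : bool) : {pred K^o} := [pred x | i ==> (x == 0)].

Fact ground_homog_submod i : submod_closed (ground_homog i).
Proof.
split=> [|a x y]; rewrite !inE ?eqxx ?implybT //.
by case: i => //= /eqP -> /eqP ->; rewrite scaler0 addr0.
Qed.

Fact ground_homog_disjoint x :
  x \in ground_homog false -> x \in ground_homog true -> x = 0.
Proof. by move=> _; rewrite inE => /eqP. Qed.

Fact ground_homog_split x : exists x0 x1,
  [/\ x0 \in ground_homog false, x1 \in ground_homog true & x = x0 + x1].
Proof. by exists x, 0; rewrite !inE eqxx addr0. Qed.

Fact ground_homog1 : 1 \in ground_homog false.
Proof. by []. Qed.

Fact ground_homogM i j x y : x \in ground_homog i -> y \in ground_homog j ->
  x * y \in ground_homog (i (+) j).
Proof.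
rewrite !inE; case: i => [/eqP->|_]; first by rewrite mul0r eqxx implybT.
by case: j => // /eqP->; rewrite mulr0 eqxx implybT.
Qed.

Fact ground_supercomm i j x y : x \in ground_homog i -> y \in ground_homog j ->
  x * y = (-1) ^+ (i && j) * (y * x).
Proof.
rewrite !inE; case: i => [/eqP->|_]; first by rewrite mul0r mulr0 mulr0.
by rewrite mul1r mulrC.
Qed.

HB.instance Definition _ := isSuperAlgebra.Build K K^o
  ground_homog_submod ground_homog_disjoint ground_homog_split
  ground_homog1 ground_homogM ground_supercomm.

Variable A : superAlgType K.

Definition scalar_inj (k : K^o) : A := (k : K)%:A.

Fact scalar_inj_nmod : nmod_morphism scalar_inj.
Proof. exact: (GRing.in_alg_is_nmod_morphism (A : lSemiAlgType K)). Qed.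
HB.instance Definition _ :=
  GRing.isNmodMorphism.Build K^o A scalar_inj scalar_inj_nmod.

Fact scalar_inj_monoid : monoid_morphism scalar_inj.
Proof. exact: (GRing.in_alg_is_monoid_morphism (A : lSemiAlgType K)). Qed.
HB.instance Definition _ :=
  GRing.isMonoidMorphism.Build K^o A scalar_inj scalar_inj_monoid.

Fact scalar_inj_scalable : scalable scalar_inj.
Proof. by move=> a x; rewrite /scalar_inj scalerA. Qed.
HB.instance Definition _ :=
  GRing.isScalable.Build K K^o A *:%R scalar_inj scalar_inj_scalable.

Fact scalar_inj_homog i x : x \in @homog K K^o i ->
  (scalar_inj : {lrmorphism K^o -> A}) x \in @homog K A i.
Proof.
have [h0 hZ] := homog_submod (s := A) i.
case: i h0 hZ => h0 hZ /=.
  by move=> /eqP ->; rewrite /= /scalar_inj scale0r.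
by move=> _; rewrite -[_ x]addr0; apply: hZ => //; exact: homog1.
Qed.

Definition superhom_scalar : {superhom K^o -> A} := SuperHom scalar_inj_homog.

End GroundField.

Section Supervarieties.
Variable K : fieldType.

Definition ideal_closed (A : nzRingType) (I : {pred A}) : Prop :=
  [/\ 0 \in I, {in I &, forall x y, x + y \in I},
      forall a, {in I, forall x, a * x \in I}
    & forall a, {in I, forall x, x * a \in I}].

(* I^odd *)
Definition in_odd_ideal (A : superAlgType K) (x : A) : Prop :=
  forall I : {pred A}, ideal_closed I -> {subset homog true <= I} -> x \in I.

Definition finitely_generated_algebra (O : comAlgType K) : Prop :=
  exists (n : nat) (g : 'I_n -> O), forall S : {pred O},
    subalg_closed S -> (forall i, g i \in S) -> forall x, x \in S.

Definition reduced (O : comAlgType K) : Prop :=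
  forall (x : O) (n : nat), x ^+ n = 0 -> x = 0.

(* Coordinate rings of ordinary, possibly reducible, affine varieties *)
Definition affine_coordinate_ring (O : comAlgType K) : Prop :=
  finitely_generated_algebra O /\ reduced O.

(* A/I^odd is presented as the target O of a surjection pi with kernel I^odd. *)
Definition bosonic_quotient_affine (A : superAlgType K) : Prop :=
  exists (O : comAlgType K) (pi : {lrmorphism A -> O}),
    [/\ forall y, exists x, pi x = y,
        forall x, pi x = 0 <-> in_odd_ideal x
      & affine_coordinate_ring O].

Definition odd_part_finite (A : superAlgType K) : Prop :=
  exists (n : nat) (g : 'I_n -> A), (forall i, g i \in homog true) /\
    forall x, x \in homog true -> exists c : 'I_n -> A,
      (forall i, c i \in homog false) /\ x = \sum_(i < n) c i * g i.

Record affineSupervariety := AffineSupervariety {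
  coord : superAlgType K;
  coord_bosonic : bosonic_quotient_affine coord;
  coord_odd : odd_part_finite coord
}.

Definition points (X : affineSupervariety) (A : superAlgType K) : Type :=
  {superhom coord X -> A}.

HB.instance Definition _ X A := Choice.on (points X A).

Definition morphism (X Y : affineSupervariety) : Type :=
  {superhom coord Y -> coord X}.

Definition points_map (X : affineSupervariety) (A B : superAlgType K)
  (h : {superhom A -> B}) (p : points X A) : points X B := h \oS p.

Definition morphism_points (X Y : affineSupervariety) (f : morphism X Y)
  (A : superAlgType K) (p : points X A) : points Y A := p \oS f.

(* The product is characterised by (X x Y)(A) = X(A) x Y(A) for every A, that
   is, coord prod_obj is the coproduct (the super tensor product) of coord X
   and coord Y. *)
Record product (X Y : affineSupervariety) := Product {
  prod_obj : affineSupervariety;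
  prod_fst : morphism prod_obj X;
  prod_snd : morphism prod_obj Y;
  prod_pair : forall A, points X A -> points Y A -> points prod_obj A;
  prod_pair_fst : forall A (x : points X A) (y : points Y A),
    morphism_points prod_fst (prod_pair x y) = x;
  prod_pair_snd : forall A (x : points X A) (y : points Y A),
    morphism_points prod_snd (prod_pair x y) = y;
  prod_pair_eta : forall A (p : points prod_obj A),
    prod_pair (morphism_points prod_fst p) (morphism_points prod_snd p) = p
}.

End Supervarieties.

Section Supergroups.
Variable K : fieldType.

(* A multiplicative map between groups is a group morphism. *)
Record supergroupFunctor := SupergroupFunctor {
  sgf_obj :> superAlgType K -> groupType;
  sgf_map : forall A B,
    {superhom A -> B} -> {multiplicative sgf_obj A -> sgf_obj B};
  sgf_map_id : forall A (x : sgf_obj A), sgf_map (superhom_id A) x = x;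
  sgf_map_comp : forall A B C (g : {superhom B -> C}) (f : {superhom A -> B})
    (x : sgf_obj A), sgf_map (g \oS f) x = sgf_map g (sgf_map f x)
}.

Definition sgf_iso (F F' : supergroupFunctor) : Prop :=
  exists phi : forall A, {multiplicative F A -> F' A},
    (forall A B (f : {superhom A -> B}) (x : F A),
       phi B (sgf_map F f x) = sgf_map F' f (phi A x)) /\
    (forall A, bijective (phi A)).

(* Naturality of the multiplication implies that of the unit and inverse. *)
Record affineSupergroup := AffineSupergroup {
  sgr_var :> affineSupervariety K;
  sgr_mul : forall A, points sgr_var A -> points sgr_var A -> points sgr_var A;
  sgr_one : forall A, points sgr_var A;
  sgr_inv : forall A, points sgr_var A -> points sgr_var A;
  sgr_mulA : forall A, associative (@sgr_mul A);
  sgr_mul1 : forall A, left_id (sgr_one A) (@sgr_mul A);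
  sgr_mulr1 : forall A, right_id (sgr_one A) (@sgr_mul A);
  sgr_mulV : forall A, left_inverse (sgr_one A) (@sgr_inv A) (@sgr_mul A);
  sgr_mulrV : forall A, right_inverse (sgr_one A) (@sgr_inv A) (@sgr_mul A);
  sgr_mul_natural : forall A B (h : {superhom A -> B}) (x y : points sgr_var A),
    points_map h (sgr_mul x y) = sgr_mul (points_map h x) (points_map h y)
}.

Definition gpoints (G : affineSupergroup) (A : superAlgType K) : Type :=
  points G A.

HB.instance Definition _ G A := Choice.on (gpoints G A).
HB.instance Definition _ G A := isGroup.Build (gpoints G A)
  (@sgr_mulA G A) (@sgr_mul1 G A) (@sgr_mulr1 G A)
  (@sgr_mulV G A) (@sgr_mulrV G A).

Section FunctorOfPoints.
Variable G : affineSupergroup.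

Definition gpoints_map A B (h : {superhom A -> B}) (g : gpoints G A) :
  gpoints G B := points_map h g.

Fact gpoints_mapM A B (h : {superhom A -> B}) :
  {morph gpoints_map h : x y / (x * y)%g}.
Proof. exact: sgr_mul_natural. Qed.

HB.instance Definition _ A B (h : {superhom A -> B}) :=
  isMultiplicative.Build _ _ (gpoints_map h) (gpoints_mapM h).

Fact gpoints_map_id A (x : gpoints G A) : gpoints_map (superhom_id A) x = x.
Proof. exact: superhom_comp1f. Qed.

Fact gpoints_map_comp A B C (g : {superhom B -> C}) (f : {superhom A -> B})
  (x : gpoints G A) : gpoints_map (g \oS f) x = gpoints_map g (gpoints_map f x).
Proof. by rewrite /gpoints_map /points_map superhom_compA. Qed.

Definition points_functor : supergroupFunctor :=
  @SupergroupFunctor (gpoints G) (fun A B h => gpoints_map h)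
    gpoints_map_id gpoints_map_comp.

End FunctorOfPoints.

Definition representable_by_affine_supergroup (F : supergroupFunctor) : Prop :=
  exists H : affineSupergroup, sgf_iso (points_functor H) F.

Record action (G : affineSupergroup) (X : affineSupervariety K) := Action {
  act_prod : product G X;
  act_mor : morphism (prod_obj act_prod) X;
  act := fun A (g : gpoints G A) (x : points X A) =>
    morphism_points act_mor (prod_pair act_prod g x);
  act1 : forall A (x : points X A), act 1%g x = x;
  actM : forall A (g h : gpoints G A) (x : points X A),
    act (g * h)%g x = act g (act h x)
}.

Section Stabilizer.
Variables (G : affineSupergroup) (X : affineSupervariety K).
Variables (a : action G X) (u : points X K^o).

(* u_A *)
Definition point_at (A : superAlgType K) : points X A :=
  points_map (superhom_scalar A) u.

Definition stab (A : superAlgType K) : {pred gpoints G A} :=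
  [pred g | act a g (point_at A) == point_at A].
Arguments stab : clear implicits.

Lemma prod_pair_natural A B (h : {superhom A -> B})
    (g : points G A) (x : points X A) :
  points_map h (prod_pair (act_prod a) g x) =
  prod_pair (act_prod a) (points_map h g) (points_map h x).
Proof.
rewrite -[LHS](@prod_pair_eta _ _ _ (act_prod a)).
rewrite /points_map /morphism_points -!superhom_compA.
rewrite -/(morphism_points (prod_fst (act_prod a)) _) prod_pair_fst.
by rewrite -/(morphism_points (prod_snd (act_prod a)) _) prod_pair_snd.
Qed.

Lemma act_natural A B (h : {superhom A -> B})
    (g : gpoints G A) (x : points X A) :
  points_map h (act a g x) = act a (gpoints_map h g) (points_map h x).
Proof.
rewrite /act /gpoints_map -prod_pair_natural.
by rewrite /morphism_points /points_map superhom_compA.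
Qed.

Lemma point_at_map A B (h : {superhom A -> B}) :
  points_map h (point_at A) = point_at B.
Proof.
rewrite /point_at /points_map superhom_compA; congr (_ \oS _).
by apply: superhomP => k /=; rewrite /scalar_inj linearZ rmorph1.
Qed.

Fact stab_group_closed A : group_closed (stab A).
Proof.
have s1 : (1%g : gpoints G A) \in stab A by rewrite !inE act1.
split=> // x y; rewrite !inE => /eqP ux /eqP uy.
rewrite actM; suff -> : act a (y^-1)%g (point_at A) = point_at A by rewrite ux.
by rewrite -{1}uy -actM mulVg act1.
Qed.

Definition stab_points (A : superAlgType K) : Type :=
  {g : gpoints G A | stab A g}.

HB.instance Definition _ A := SubChoice.on (stab_points A).
HB.instance Definition _ A :=
  SubChoice_isSubGroup.Build _ _ (stab_points A) (@stab_group_closed A).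

Fact stab_map_subproof A B (h : {superhom A -> B}) (g : stab_points A) :
  stab B (gpoints_map h (val g)).
Proof.
have /eqP ug := valP g.
by rewrite /stab /= -(point_at_map h) -act_natural ug.
Qed.

Definition stab_map A B (h : {superhom A -> B}) (g : stab_points A) :
  stab_points B := Sub (gpoints_map h (val g)) (stab_map_subproof h g).

Fact stab_mapM A B (h : {superhom A -> B}) :
  {morph stab_map h : x y / (x * y)%g}.
Proof. by move=> x y; apply: val_inj; rewrite /= gpoints_mapM. Qed.

HB.instance Definition _ A B (h : {superhom A -> B}) :=
  isMultiplicative.Build _ _ (stab_map h) (stab_mapM h).

Fact stab_map_id A (x : stab_points A) : stab_map (superhom_id A) x = x.
Proof. by apply: val_inj; exact: gpoints_map_id. Qed.

Fact stab_map_comp A B C (g : {superhom B -> C}) (f : {superhom A -> B})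
  (x : stab_points A) : stab_map (g \oS f) x = stab_map g (stab_map f x).
Proof. by apply: val_inj; exact: gpoints_map_comp. Qed.

Definition Stab : supergroupFunctor :=
  @SupergroupFunctor stab_points (fun A B h => stab_map h)
    stab_map_id stab_map_comp.

End Stabilizer.

End Supergroups.

(* Main.v *)
From HB Require Import structures.
Require Import Defs.
From mathcomp Require Import all_boot all_order all_algebra.
From mathcomp Require Import ring_quotient boolp.
From mathcomp Require Import zify ring.

(** Write [A] for the coordinate superalgebra of [G] and [phi] for the morphism
from the coordinate superalgebra of [X] to [A] given by the orbit map of [u],
that is, by the action of the universal point of [G] on [u]. Naturality of the
action turns the condition that a point [g] of [G] fixes [u] into the equations
[g (phi x) = u x] ([stabP]). The elements of [A] killed by all stabilizing
points form a proper homogeneous ideal, and the quotient [H] of [A] by it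
represents the stabilizer ([stab_universal]). The group structure on the points
of [H] is transported from the stabilizer functor, and [H] inherits from [A]
the finiteness conditions.

What remains is that [O], the quotient of [H] by its odd ideal, is reduced.
This is a form of Cartier's theorem, that group schemes of finite type in
characteristic zero are reduced. Its proof has two parts.

- Homogeneity ([lift_point_derivation]): every tangent vector [w] at every
  point [p] of [O] is the value at [p] of a derivation of [O]. Over the dual
  numbers [w] is a point [p + w t] of the stabilizer, and multiplying the
  universal point by the infinitesimal element that carries [p] to [p + w t]
  moves it by a vector field with value [w] at [p].

- Such an algebra is reduced ([reduced_of_lifted_derivations]). Let [m] be the
  ideal of a point. If derivations [D_i] take at this point the values dual to
  a basis [x_i] of [m / m^2], then the Euler field [E = \sum_i x_i D_i] acts on
  [m^n / m^(n + 1)] as multiplication by [n]. Derivations preserve nilpotency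
  in characteristic zero, so if all nilpotents are in [m^n], then [E] maps
  them into [m^(n + 1)], and they are all in [m^(n + 1)]. A nilpotent [a] is
  thus in every power of [m], and Krull's intersection theorem
  ([krull_intersection]) gives [a = z * a] with [z] in [m], so that [1 - z]
  kills [a]. The annihilator of [a] then vanishes at no point, and the
  Nullstellensatz ([exists_point_of_proper_ideal]) forces [a = 0].

Krull's theorem is derived from Hilbert's basis theorem for the Rees algebra
of [m]; the Nullstellensatz uses that the complex field is uncountable. *)

Set Implicit Arguments.
Unset Strict Implicit.
Unset Printing Implicit Defensive.

Import GRing.Theory.
Local Open Scope ring_scope.

(** * Noetherian subrings and Hilbert's basis theorem *)

Section Subrings.
Variable S : comNzRingType.
Implicit Types (R G : S -> Prop).

(** Subrings are predicates on an ambient ring, so that subrings generated by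
finitely many elements, Rees algebras in particular, need no type of their own. *)
Definition subring_set R : Prop :=
  [/\ R 1, forall x y, R x -> R y -> R (x - y)
    & forall x y, R x -> R y -> R (x * y)].

Lemma subring_set0 R : subring_set R -> R 0.
Proof. by case=> r1 rB _; rewrite -(subrr 1); apply: rB. Qed.

Lemma subring_setN R x : subring_set R -> R x -> R (- x).
Proof.
move=> rR rx; rewrite -sub0r; case: (rR) => _ rB _; apply: rB => //.
exact: subring_set0.
Qed.

Lemma subring_setD R x y : subring_set R -> R x -> R y -> R (x + y).
Proof.
move=> rR rx ry; rewrite -[y]opprK; case: (rR) => _ rB _; apply: rB => //.
exact: subring_setN.
Qed.

Lemma subring_set_sum R I (r : seq I) (F : I -> S) : subring_set R ->
  (forall i, R (F i)) -> R (\sum_(i <- r) F i).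
Proof.
move=> rR rF; elim/big_rec: _ => [|i x _]; first exact: subring_set0.
exact: subring_setD.
Qed.

Lemma subring_setX R x n : subring_set R -> R x -> R (x ^+ n).
Proof.
move=> [r1 rB rM] rx; elim: n => [|n IH]; first by rewrite expr0.
by rewrite exprS; apply: rM.
Qed.

Inductive ideal_span R G : S -> Prop :=
| ideal_span0 : ideal_span R G 0
| ideal_spanD x y : ideal_span R G x -> ideal_span R G y ->
    ideal_span R G (x + y)
| ideal_spanM r g : R r -> G g -> ideal_span R G (r * g).

Lemma sub_ideal_span R G G' x :
  (forall y, G y -> G' y) -> ideal_span R G x -> ideal_span R G' x.
Proof.
move=> sGG'; elim=> [|y z _ hy _ hz|r g rr gg]; first exact: ideal_span0.
  exact: ideal_spanD.
by apply: ideal_spanM => //; apply: sGG'.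
Qed.

Lemma ideal_span_mulr R G r x : subring_set R ->
  R r -> ideal_span R G x -> ideal_span R G (r * x).
Proof.
move=> [_ _ rM] rr; elim=> [|y z _ hy _ hz|s g rs gg].
- by rewrite mulr0; apply: ideal_span0.
- by rewrite mulrDr; apply: ideal_spanD.
- by rewrite mulrA; apply: ideal_spanM => //; apply: rM.
Qed.

Lemma ideal_span_gen R G x : subring_set R -> G x -> ideal_span R G x.
Proof. by move=> [r1 _ _] gx; rewrite -[x]mul1r; apply: ideal_spanM. Qed.

Lemma ideal_span_trans R G G' x : subring_set R ->
  (forall y, G y -> ideal_span R G' y) -> ideal_span R G x -> ideal_span R G' x.
Proof.
move=> rR sG; elim=> [|y z _ hy _ hz|r g rr gg]; first exact: ideal_span0.
  exact: ideal_spanD.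
by apply: ideal_span_mulr => //; apply: sG.
Qed.

Lemma ideal_span_sub R G x : subring_set R -> (forall y, G y -> R y) ->
  ideal_span R G x -> R x.
Proof.
move=> rR sGR; elim=> [|y z _ hy _ hz|r g rr gg].
- exact: subring_set0.
- exact: subring_setD.
- by case: rR => _ _ rM; apply: rM => //; apply: sGR.
Qed.

Definition earlier (f : nat -> S) N : S -> Prop :=
  fun x => exists2 i, (i < N)%N & x = f i.

(** The ascending chain condition in the form used below: no sequence in [R] has
all its terms outside the ideal of [R] spanned by the earlier ones. *)
Definition noetherian R : Prop := forall f : nat -> S,
  (forall n, R (f n)) -> exists N, ideal_span R (earlier f N) (f N).

End Subrings.

Lemma noetherian_field (K : fieldType) : noetherian (fun _ : K => True).
Proof.
move=> f _; have [f0|f0] := eqVneq (f 0%N) 0.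
  by exists 0%N; rewrite f0; apply: ideal_span0.
exists 1%N; rewrite -[f 1%N](divfK f0); apply: ideal_spanM => //.
by exists 0%N.
Qed.

Definition image_set (S S' : Type) (h : S -> S') (R : S -> Prop) : S' -> Prop :=
  fun y => exists2 x, R x & h x = y.

Lemma subring_set_image (S S' : comNzRingType) (h : {rmorphism S -> S'}) R :
  subring_set R -> subring_set (image_set h R).
Proof.
move=> [r1 rB rM]; split; first by exists 1; rewrite ?rmorph1.
- move=> _ _ [x rx <-] [y ry <-]; exists (x - y); first exact: rB.
  by rewrite rmorphB.
- move=> _ _ [x rx <-] [y ry <-]; exists (x * y); first exact: rM.
  by rewrite rmorphM.
Qed.

Lemma noetherian_image (S S' : comNzRingType) (h : {rmorphism S -> S'}) R :
  noetherian R -> noetherian (image_set h R).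
Proof.
move=> nR f rf.
have /choice[g gP] : forall n, exists x, R x /\ h x = f n.
  by move=> n; have [x rx hx] := rf n; exists x.
have [N hN] := nR g (fun n => (gP n).1); exists N; rewrite -(gP N).2.
elim: hN => [|y z _ hy _ hz|r x rr [i iN ->]].
- by rewrite rmorph0; apply: ideal_span0.
- by rewrite rmorphD; apply: ideal_spanD.
- rewrite rmorphM; apply: ideal_spanM; first by exists r.
  by exists i => //; rewrite (gP i).2.
Qed.

(** Dependent choice in which each term may depend on all the earlier ones. *)
Lemma history_choice (T : Type) (P : seq T -> T -> Prop) :
    (forall l, exists x, P l x) ->
  exists f : nat -> T, forall n, P (mkseq f n) (f n).
Proof.
move=> /choice[step stepP].
pose l := fix l n := if n is n'.+1 then rcons (l n') (step (l n')) else [::].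
exists (fun n => step (l n)) => n.
suff -> : mkseq (fun n => step (l n)) n = l n by [].
by elim: n => //= n IH; rewrite mkseqS IH.
Qed.

Definition poly_over (S : nzRingType) (R : S -> Prop) : {poly S} -> Prop :=
  fun P => forall i, R P`_i.

Section HilbertBasis.
Variables (S : comNzRingType) (R : S -> Prop).
Hypothesis rR : subring_set R.

Lemma subring_set_poly : subring_set (poly_over R).
Proof.
have r0 := subring_set0 rR; case: (rR) => r1 rB rM; split.
- by move=> i; rewrite coef1; case: eqP.
- by move=> x y rx ry i; rewrite coefB; apply: rB.
- move=> x y rx ry i; rewrite coefM; apply: subring_set_sum => // j.
  exact: rM.
Qed.

Lemma poly_over_Xn n : poly_over R 'X^n.
Proof. by move=> i; rewrite coefXn; case: eqP => _; [case: rR|apply: subring_set0]. Qed.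

Lemma poly_over_C c : R c -> poly_over R c%:P.
Proof. by move=> rc i; rewrite coefC; case: eqP => // _; apply: subring_set0. Qed.

Hypothesis nR : noetherian R.

(** Hilbert's basis theorem. In a sequence violating the chain condition for
[R[X]], the ideal of all its terms is not spanned by finitely many of its
elements. One picks successively [G 0], [G 1], ... in it, each of minimal size
outside the span of the previous ones. The leading coefficient of some [G N] is
a combination of the earlier leading coefficients, and subtracting the matching
combination of shifted polynomials contradicts the minimality of [G N]. *)
Theorem noetherian_poly : noetherian (poly_over R).
Proof.
have rRX := subring_set_poly; have [rX1 rXB rXM] := rRX.
move=> F rF; apply: contrapT => /forallNP badF.
pose I (x : {poly S}) := exists M, ideal_span (poly_over R) (earlier F M) x.
have earlierS M N x : (M <= N)%N -> earlier F M x -> earlier F N x.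
  by move=> MN [i iM ->]; exists i => //; apply: leq_trans MN.
have Imono M N x : (M <= N)%N -> ideal_span (poly_over R) (earlier F M) x ->
    ideal_span (poly_over R) (earlier F N) x.
  by move=> MN; apply: sub_ideal_span => y; apply: earlierS.
have I_D x y : I x -> I y -> I (x + y).
  move=> [M Mx] [N Ny]; exists (maxn M N); apply: ideal_spanD.
    by apply: Imono Mx; apply: leq_maxl.
  by apply: Imono Ny; apply: leq_maxr.
have I_M r x : poly_over R r -> I x -> I (r * x).
  by move=> rr [M Mx]; exists M; apply: ideal_span_mulr.
have I_R x : I x -> poly_over R x.
  by case=> M; apply: ideal_span_sub => // y [i _ ->].
have fresh (l : seq {poly S}) : (forall y, y \in l -> I y) ->
    exists2 x, I x & ~ ideal_span (poly_over R) (fun y => y \in l) x.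
  move=> lI.
  have [M lM] : exists M, forall y, y \in l ->
      ideal_span (poly_over R) (earlier F M) y.
    elim: l lI => [|y l IH] lI; first by exists 0%N.
    have [|M lM] := IH; first by move=> z zl; apply: lI; rewrite inE zl orbT.
    have [N yN] := lI y (mem_head _ _); exists (maxn M N) => z.
    rewrite inE => /predU1P[->|/lM zM].
      by apply: Imono yN; apply: leq_maxr.
    by apply: Imono zM; apply: leq_maxl.
  exists (F M).
    by exists M.+1; apply: ideal_span_gen => //; exists M.
  by move=> /(ideal_span_trans rRX lM); apply: badF.
pose P (l : seq {poly S}) (x : {poly S}) := (forall y, y \in l -> I y) ->
  [/\ I x, ~ ideal_span (poly_over R) (fun y => y \in l) x
    & forall z, I z -> ~ ideal_span (poly_over R) (fun y => y \in l) z ->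
        (size x <= size z)%N].
have [|G GP] := @history_choice {poly S} P.
  move=> l; have [lI|] := pselect (forall y, y \in l -> I y); last first.
    by move=> nlI; exists 0 => /nlI.
  pose Q n := `[< exists x : {poly S}, [/\ I x,
    ~ ideal_span (poly_over R) (fun y => y \in l) x & size x = n] >].
  have exQ : exists n, Q n.
    by have [x Ix lx] := fresh l lI; exists (size x); apply/asboolP; exists x.
  case: (ex_minnP exQ) => n /asboolP[x [Ix lx <-]] xmin.
  exists x => _; split=> // z Iz lz; apply: xmin; apply/asboolP.
  by exists z.
have memG n (y : {poly S}) : y \in mkseq G n <-> earlier G n y.
  split; last by move=> [j jn ->]; apply: map_f; rewrite mem_iota.
  by move=> /mapP[j]; rewrite mem_iota => jn ->; exists j.
have GI n : I (G n).
  elim/ltn_ind: n => n IH; have [] // := GP n.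
  by move=> y /memG[i iln ->]; apply: IH.
have GP' n : ~ ideal_span (poly_over R) (earlier G n) (G n) /\
    forall z, I z -> ~ ideal_span (poly_over R) (earlier G n) z ->
      (size (G n) <= size z)%N.
  have [|_ hG minG] := GP n; first by move=> y /memG[i _ ->].
  split=> [hG'|z Iz hz].
    by apply: hG; apply: sub_ideal_span hG' => y /memG.
  by apply: minG => // hz'; apply: hz; apply: sub_ideal_span hz' => y /memG.
have sizeG i n : (i <= n)%N -> (size (G i) <= size (G n))%N.
  move=> iln; apply: (GP' i).2 => // hG; apply: (GP' n).1.
  apply: sub_ideal_span hG => y [j ji ->]; exists j => //.
  exact: leq_trans iln.
have [N hN] := nR (f := fun n => lead_coef (G n)) (fun n => I_R _ (GI n) _).
pose d := size (G N).
have d_gt0 : (0 < d)%N.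
  rewrite lt0n size_poly_eq0; apply/eqP => GN0; apply: (GP' N).1.
  by rewrite GN0; apply: ideal_span0.
(* The combination of the earlier polynomials, shifted by powers of 'X, that
   has the leading term of [G N]. *)
have [Q [hQ sQ cQ]] : exists Q, [/\ ideal_span (poly_over R) (earlier G N) Q,
    (size Q <= d)%N & Q`_d.-1 = lead_coef (G N)].
  elim: hN => [|y z _ [Q1 [h1 s1 c1]] _ [Q2 [h2 s2 c2]]|r _ rr [i iN ->]].
  - by exists 0; rewrite size_poly0 coef0; split=> //; apply: ideal_span0.
  - exists (Q1 + Q2); split; first exact: ideal_spanD.
      by rewrite (leq_trans (size_polyD _ _)) // geq_max s1 s2.
    by rewrite coefD c1 c2.
  - have sGi : (size (G i) <= d)%N := sizeG _ _ (ltnW iN).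
    exists (r%:P * 'X^(d - size (G i)) * G i); split.
    + apply: ideal_spanM; last by exists i.
      by apply: rXM; [apply: poly_over_C|apply: poly_over_Xn].
    + rewrite -mulrA mul_polyC (leq_trans (size_scale_leq _ _)) //.
      by rewrite mulrC (leq_trans (size_polyMleq _ _)) // size_polyXn addnS /= subnKC.
    + rewrite -mulrA mul_polyC coefZ; congr (_ * _).
      rewrite [_ * G i]mulrC coefMXn /lead_coef.
      have -> : (d.-1 < d - size (G i))%N = (size (G i) == 0%N) by lia.
      case: eqP => [s0|s0]; first by rewrite nth_default // s0.
      by congr _`_ _; lia.
pose Z := G N - Q.
have IQ : I Q.
  elim: hQ => [|y z _ hy _ hz|r _ rr [i iN ->]]; last by apply: I_M.
    by exists 0%N; apply: ideal_span0.
  exact: I_D.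
have IZ : I Z.
  apply: I_D => //; rewrite -mulN1r; apply: I_M => //.
  exact: (subring_setN rRX rX1).
have hZ : ~ ideal_span (poly_over R) (earlier G N) Z.
  by move=> hZ; apply: (GP' N).1; rewrite -[G N](subrK Q); apply: ideal_spanD.
have := (GP' N).2 _ IZ hZ; apply/negP; rewrite -ltnNge.
have sZ : (size Z <= d)%N.
  by rewrite (leq_trans (size_polyD _ _)) // geq_max size_polyN sQ leqnn.
rewrite -/d -(prednK d_gt0) ltnS; apply/leq_sizeP => j.
rewrite leq_eqVlt => /predU1P[<-|]; last first.
  by rewrite prednK // => dj; apply/leq_sizeP: dj.
by rewrite coefB cQ /lead_coef -/d subrr.
Qed.

End HilbertBasis.

(** The subring generated by [R] and [l], adjoined one generator [g] at a time:
[R[g]] is the image of the polynomials over [R] under evaluation at [g]. *)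
Lemma noetherian_adjoin (S : comNzRingType) (R : S -> Prop) (l : seq S) :
    subring_set R -> noetherian R ->
  exists R' : S -> Prop, [/\ subring_set R', noetherian R',
    forall x, R x -> R' x, forall x, x \in l -> R' x
  & forall Q : S -> Prop, subring_set Q -> (forall x, R x -> Q x) ->
      (forall x, x \in l -> Q x) -> forall x, R' x -> Q x].
Proof.
move=> rR nR; elim: l => [|g l [R1 [r1 n1 R1R R1l R1Q]]].
  by exists R; split=> // Q _ RQ _.
pose h : {rmorphism {poly S} -> S} := horner_eval g.
exists (image_set h (poly_over R1)); split.
- by apply: subring_set_image; apply: subring_set_poly.
- by apply: noetherian_image; apply: noetherian_poly.
- move=> x rx; exists x%:P; last by rewrite /= /horner_eval hornerC.
  by apply: poly_over_C => //; apply: R1R.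
- move=> x; rewrite inE => /predU1P[->|xl].
    exists 'X; last by rewrite /= /horner_eval hornerX.
    by rewrite -['X]expr1; apply: poly_over_Xn.
  exists x%:P; last by rewrite /= /horner_eval hornerC.
  by apply: poly_over_C => //; apply: R1l.
- move=> Q rQ RQ Ql _ [P rP <-]; rewrite /= /horner_eval horner_coef.
  apply: subring_set_sum => // i; case: (rQ) => _ _ QM; apply: QM.
    apply: R1Q => // x xl; apply: Ql; rewrite inE xl orbT //.
  by apply: subring_setX => //; apply: Ql; rewrite mem_head.
Qed.

(** * Powers of the ideal of a point and Krull's intersection theorem *)

(** Written with [in_alg] so that the rewriting can be iterated: [k%:A] would itself
be a scaling, and the inverse of [mulr_algl] rewrites forever. *)
Lemma scale_in_alg (K : fieldType) (O : comAlgType K) (k : K) (x : O) :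
  k *: x = in_alg O k * x.
Proof. by rewrite /= mulr_algl. Qed.

Definition subalgebra_set (K : fieldType) (O : comAlgType K) (P : O -> Prop) :=
  [/\ forall k : K, P k%:A, forall x y, P x -> P y -> P (x + y)
    & forall x y, P x -> P y -> P (x * y)].

Definition generates (K : fieldType) (O : comAlgType K) n (g : 'I_n -> O) :=
  forall P : O -> Prop, subalgebra_set P -> (forall i, P (g i)) ->
  forall x, P x.

Lemma finitely_generatedP (K : fieldType) (O : comAlgType K) :
  finitely_generated_algebra O <-> exists n (g : 'I_n -> O), generates g.
Proof.
split=> [] [n [g gP]]; exists n, g.
- move=> P [PA PD PM] Pg x.
  suff : x \in [pred y | `[< P y >]] by rewrite inE => /asboolP.
  have PZ k y : P y -> P (k *: y).
    by move=> Py; rewrite -mulr_algl; apply: PM.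
  apply: gP; last by move=> i; rewrite inE; apply/asboolP.
  split; first by rewrite inE; apply/asboolP; rewrite -(scale1r 1).
    move=> k y z; rewrite !inE => /asboolP Py /asboolP Pz; apply/asboolP.
    by apply: PD => //; apply: PZ.
  move=> y z; rewrite !inE => /asboolP Py /asboolP Pz; apply/asboolP.
  exact: PM.
- move=> S [S1 SZ SM] Sg; apply: (gP (fun x => x \in S)) => //.
  have S0 : 0 \in S by rewrite -(addNr 1) -scaleN1r; apply: SZ.
  split=> [k|x y Sx Sy|x y Sx Sy]; last exact: SM.
    by rewrite -[_%:A]addr0; apply: SZ.
  by rewrite -[x]scale1r; apply: SZ.
Qed.

(** The powers of the ideal [m]; the 0th power is the whole ring. An inductive
presentation makes statements on [m^n] provable on products [x * y] with [x] in
[m] and [y] in the previous power. *)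
Inductive ideal_power (S : comNzRingType) (m : S -> Prop) : nat -> S -> Prop :=
| ideal_power_all x : ideal_power m 0 x
| ideal_power_0 n : ideal_power m n 0
| ideal_power_D n x y : ideal_power m n x -> ideal_power m n y ->
    ideal_power m n (x + y)
| ideal_power_M n x y : m x -> ideal_power m n y ->
    ideal_power m n.+1 (x * y).

Definition ideal_set (S : comNzRingType) (m : S -> Prop) : Prop :=
  [/\ m 0, forall x y, m x -> m y -> m (x + y) & forall a x, m x -> m (a * x)].

Section IdealPowers.
Variables (S : comNzRingType) (m : S -> Prop).
Hypothesis mI : ideal_set m.

Lemma ideal_power_mull n a x : ideal_power m n x -> ideal_power m n (a * x).
Proof.
case: mI => _ _ mM; elim=> {n x} [x|n|n x y _ hx _ hy|n x y mx hy _].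
- exact: ideal_power_all.
- by rewrite mulr0; apply: ideal_power_0.
- by rewrite mulrDr; apply: ideal_power_D.
- by rewrite mulrA; apply: ideal_power_M => //; apply: mM.
Qed.

Lemma ideal_powerN n x : ideal_power m n x -> ideal_power m n (- x).
Proof. by move=> hx; rewrite -mulN1r; apply: ideal_power_mull. Qed.

Lemma ideal_powerB n x y : ideal_power m n x -> ideal_power m n y ->
  ideal_power m n (x - y).
Proof. by move=> hx hy; apply: ideal_power_D => //; apply: ideal_powerN. Qed.

Lemma ideal_power_sum n I (r : seq I) (P : pred I) F :
  (forall i, P i -> ideal_power m n (F i)) ->
  ideal_power m n (\sum_(i <- r | P i) F i).
Proof.
move=> hF; elim/big_rec: _ => [|i x Pi hx]; first exact: ideal_power_0.
by apply: ideal_power_D => //; apply: hF.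
Qed.

Lemma ideal_power1 x : m x <-> ideal_power m 1 x.
Proof.
case: mI => m0 mD mM; split=> [mx|].
  by rewrite -[x]mulr1; apply: ideal_power_M => //; apply: ideal_power_all.
suff gen n y : ideal_power m n y -> n = 1%N -> m y by move=> hx; apply: gen hx _.
elim=> {n y} // [n y z _ hy _ hz n1|n y z my _ _ _].
  by apply: mD; [apply: hy|apply: hz].
by rewrite mulrC; apply: mM.
Qed.

Lemma ideal_powerM i j x y : ideal_power m i x -> ideal_power m j y ->
  ideal_power m (i + j) (x * y).
Proof.
move=> hx hy; elim: hx => {i x} [x|i|i x x' _ hx _ hx'|i x x' mx _ hx'].
- exact: ideal_power_mull.
- by rewrite mul0r; apply: ideal_power_0.
- by rewrite mulrDl; apply: ideal_power_D.
- by rewrite -mulrA; apply: ideal_power_M.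
Qed.

Lemma ideal_powerS n x : ideal_power m n.+1 x -> ideal_power m n x.
Proof.
move hk : n.+1 => k hx; elim: hx n hk => {k x} // [k|k x y _ hx _ hy|k x y _ hy _] n hk.
- exact: ideal_power_0.
- by apply: ideal_power_D; [apply: hx|apply: hy].
- by case: hk => ->; apply: ideal_power_mull.
Qed.

Lemma ideal_power_gt0 n x : (0 < n)%N -> ideal_power m n x -> m x.
Proof.
case: n => // n _; elim: n => [|n IH] hx; first exact/ideal_power1.
by apply: IH; apply: ideal_powerS.
Qed.

End IdealPowers.

Section Krull.
Variables (K : fieldType) (O : comAlgType K) (p : {lrmorphism O -> K^o}).

Definition point_ideal (x : O) : Prop := p x = 0.

Lemma point_ideal_set : ideal_set point_ideal.
Proof.
rewrite /point_ideal; split=> [|x y hx hy|a x hx]; first exact: rmorph0.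
  by rewrite rmorphD /= hx hy addr0.
by rewrite rmorphM /= hx mulr0.
Qed.

Lemma point_scalar (k : K) : p k%:A = k.
Proof. by rewrite linearZ rmorph1 [LHS]mulr1. Qed.

Lemma pointD x y : p (x + y) = (p x : K) + (p y : K).
Proof. exact: rmorphD. Qed.

Lemma pointM x y : p (x * y) = (p x : K) * (p y : K).
Proof. exact: rmorphM. Qed.

Lemma sub_pointM x y : x * y - (p (x * y))%:A =
  x * (y - (p y)%:A) + (p y)%:A * (x - (p x)%:A).
Proof.
by rewrite pointM !mulrBr mulr_algr mulr_algl -scalerAl mul1r scalerA
  [(p x : K) * _]mulrC addrA subrK.
Qed.

Lemma sub_point x : point_ideal (x - (p x)%:A).
Proof. by rewrite /point_ideal rmorphB /= point_scalar subrr. Qed.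

Let m := point_ideal.
Let mI := point_ideal_set.

(** The Rees algebra of the ideal of [p]: the polynomials whose coefficient of 'X^i
lies in its [i]th power. *)
Definition rees (P : {poly O}) : Prop := forall i, ideal_power m i P`_i.

Lemma subring_set_rees : subring_set rees.
Proof.
split=> [i|P Q hP hQ i|P Q hP hQ i].
- rewrite coef1; case: i => [|i]; first exact: ideal_power_all.
  exact: ideal_power_0.
- by rewrite coefB; apply: ideal_powerB.
- rewrite coefM; apply: ideal_power_sum => // j _.
  by rewrite -{1}(subnKC (ltn_ord j : j <= i)%N); apply: ideal_powerM.
Qed.

(** The Rees algebra is generated over the field by the generators [g j] of [O] in
degree 0 and the elements [g j - p (g j)] in degree 1, hence it is noetherian.
If [b] is in all powers, then the monomials [b 'X^k] lie in it, and some
[b 'X^N] is a combination of those with [k < N]. In degree [N] this reads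
[b = z * b], where [z] is a sum of coefficients of positive degree. *)
Theorem krull_intersection b : finitely_generated_algebra O ->
  (forall n, ideal_power m n b) -> exists2 z, p z = 0 & b = z * b.
Proof.
move=> /finitely_generatedP[n [g gP]] hb.
pose c : {rmorphism K -> {poly O}} := (polyC \o in_alg O).
pose l := [seq (g j)%:P | j <- enum 'I_n] ++
  [seq (g j - (p (g j))%:A)%:P * 'X | j <- enum 'I_n].
have rK : subring_set (fun _ : K => True) by [].
(* [R] is the Rees algebra: [Rpow] and [Rrees] below give the two inclusions. *)
have [R [rR nR KR lR RQ]] := noetherian_adjoin l (subring_set_image c rK)
  (noetherian_image (h := c) (@noetherian_field K)).
have RK k : R (k%:A)%:P by apply: KR; exists k.
have [_ _ RM] := rR.
have Rg j : R (g j)%:P.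
  apply: lR; rewrite mem_cat; apply/orP; left.
  by apply/mapP; exists j; rewrite ?mem_enum.
have RgX j : R ((g j - (p (g j))%:A)%:P * 'X).
  apply: lR; rewrite mem_cat; apply/orP; right.
  by apply/mapP; exists j; rewrite ?mem_enum.
have RC x : R x%:P.
  apply: (gP (fun x => R x%:P)) => //; split=> // y z hy hz.
    by rewrite polyCD; apply: subring_setD.
  by rewrite polyCM; apply: RM.
have RX x : R ((x - (p x)%:A)%:P * 'X).
  apply: (gP (fun x => R ((x - (p x)%:A)%:P * 'X))) => //; split=> [k|y z hy hz|y z hy hz].
  - by rewrite point_scalar subrr mul0r; apply: subring_set0.
  - rewrite pointD scalerDl opprD addrACA polyCD mulrDl.
    exact: subring_setD.
  - rewrite sub_pointM.
    by rewrite polyCD !polyCM mulrDl -!mulrA; apply: subring_setD => //; apply: RM.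
have Rpow k x : ideal_power m k x -> R (x%:P * 'X^k).
  elim=> {k x} [x|k|k x y _ hx _ hy|k x y mx _ hy].
  - by rewrite expr0 mulr1.
  - by rewrite mul0r; apply: subring_set0.
  - by rewrite polyCD mulrDl; apply: subring_setD.
  - rewrite polyCM exprS mulrACA; apply: RM => //.
    by have := RX x; rewrite mx scale0r subr0.
have Rrees P : R P -> rees P.
  apply: RQ; first exact: subring_set_rees.
    move=> _ [k _ <-] i; rewrite /= coefC; case: i => [|i]; first exact: ideal_power_all.
    exact: ideal_power_0.
  move=> Q; rewrite mem_cat => /orP[] /mapP[j _ ->] i.
    rewrite coefC; case: i => [|i]; first exact: ideal_power_all.
    exact: ideal_power_0.
  rewrite coefCM coefX; case: eqP => [->|_]; last by rewrite mulr0; apply: ideal_power_0.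
  rewrite mulr1; apply/(ideal_power1 mI); exact: sub_point.
have [N hN] := nR (fun k => b%:P * 'X^k) (fun k => Rpow _ _ (hb k)).
suff [z mz bz] : exists2 z, m z & (b%:P * 'X^N)`_N = z * b.
  by exists z; rewrite // -bz coefCM coefXn eqxx mulr1.
elim: hN => [|x y _ [z mz hz] _ [t mt ht]|r _ Rr [i iN ->]].
- by exists 0; [exact: rmorph0|rewrite coef0 mul0r].
- exists (z + t); first by case: mI => _ mD _; apply: mD.
  by rewrite coefD hz ht mulrDl.
- exists r`_(N - i); last by rewrite mulrA coefMXn ltnNge (ltnW iN) /= coefMC.
  by apply: (ideal_power_gt0 mI _ (Rrees _ Rr (N - i)%N)); rewrite subn_gt0.
Qed.

End Krull.

(** * The Nullstellensatz over an uncountable field *)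

From mathcomp Require Import finmap classical_sets cardinality.
From mathcomp Require Import constructive_ereal measure lebesgue_measure.

Lemma lrmorphism_of (K : fieldType) (A B : algType K) (f : A -> B) :
    linear f -> f 1 = 1 -> {morph f : x y / x * y} ->
  {F : {lrmorphism A -> B} | F =1 f}.
Proof.
move=> fL f1 fM.
pose mL := GRing.isLinear.Build K A B *:%R f fL.
pose mM := GRing.isMonoidMorphism.Build A B f (f1, fM).
by exists (HB.pack_for {lrmorphism A -> B} f mL mM).
Qed.

Section Span.
Variables (K : fieldType) (V : lmodType K).
Implicit Types (s : seq V) (x y : V).

Definition in_span s x : Prop :=
  exists a : 'I_(size s) -> K, x = \sum_i a i *: s`_i.

Lemma in_spanD s x y : in_span s x -> in_span s y -> in_span s (x + y).
Proof.
move=> [a ->] [b ->]; exists (fun i => a i + b i); rewrite -big_split /=.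
by apply: eq_bigr => i _; rewrite scalerDl.
Qed.

Lemma in_spanZ s k x : in_span s x -> in_span s (k *: x).
Proof.
move=> [a ->]; exists (fun i => k * a i); rewrite scaler_sumr.
by apply: eq_bigr => i _; rewrite scalerA.
Qed.

Lemma in_span_sum s I (r : seq I) (F : I -> V) :
  (forall i, in_span s (F i)) -> in_span s (\sum_(i <- r) F i).
Proof.
move=> hF; elim/big_rec: _ => [|i x _]; last exact: in_spanD.
by exists (fun=> 0); rewrite big1 // => i _; rewrite scale0r.
Qed.

Lemma mem_in_span s x : x \in s -> in_span s x.
Proof.
move=> xs; have xsize : (index x s < size s)%N by rewrite index_mem.
exists (fun i => (i == Ordinal xsize)%:R).
rewrite (bigD1 (Ordinal xsize)) //= eqxx scale1r nth_index // big1 ?addr0 //.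
by move=> i /negPf ->; rewrite scale0r.
Qed.

Lemma in_span_trans s s' x :
  (forall y, y \in s -> in_span s' y) -> in_span s x -> in_span s' x.
Proof.
move=> ss' [a ->]; apply: in_span_sum => i; apply: in_spanZ; apply: ss'.
exact: mem_nth.
Qed.

Lemma in_span_dependent s (h : 'I_(size s).+1 -> V) :
    (forall i, in_span s (h i)) ->
  exists2 v : 'I_(size s).+1 -> K, exists i, v i != 0 & \sum_i v i *: h i = 0.
Proof.
move=> /choice[a ha]; pose M := \matrix_(i, j) a i j.
have /rowV0Pn[v /sub_kermxP vM v0] : kermx M != 0.
  rewrite kermx_eq0 -row_leq_rank -ltnNge ltnS; exact: rank_leq_col.
exists (v 0).
  apply: contrapT => /forallNP hv; case/negP: v0; apply/eqP/rowP => i.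
  by rewrite mxE; apply/eqP; apply: contrapT => /negP; apply: hv.
under eq_bigr do rewrite ha scaler_sumr.
rewrite exchange_big big1 //= => j _.
under eq_bigr do rewrite scalerA.
have /matrixP/(_ 0 j) := vM; rewrite !mxE => vMj.
rewrite -scaler_suml (_ : \sum_i _ = 0) ?scale0r // -[RHS]vMj.
by apply: eq_bigr => i _; rewrite mxE.
Qed.

End Span.

Lemma countably_spanned (K : fieldType) (O : comAlgType K) :
  finitely_generated_algebra O ->
  exists L : nat -> seq O, forall x, exists n, in_span (L n) x.
Proof.
move=> /finitely_generatedP[n [g gP]].
pose L := fix L k := if k is k'.+1 then
   L k' ++ [seq g j * y | j <- enum 'I_n, y <- L k'] else [:: 1 : O].
exists L; pose V x := exists k, in_span (L k) x.
have Lmono i j x : (i <= j)%N -> in_span (L i) x -> in_span (L j) x.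
  move=> /subnK <-; elim: (j - i)%N => // k IH /IH.
  by apply: in_span_trans => y yL; apply: mem_in_span; rewrite mem_cat yL.
have VD x y : V x -> V y -> V (x + y).
  move=> [i xi] [j yj]; exists (maxn i j); apply: in_spanD.
    by apply: Lmono xi; apply: leq_maxl.
  by apply: Lmono yj; apply: leq_maxr.
have Vg j x : V x -> V (g j * x).
  move=> [k [a ->]]; exists k.+1; rewrite mulr_sumr; apply: in_span_sum => i.
  rewrite -scalerAr; apply: in_spanZ; apply: mem_in_span.
  rewrite mem_cat; apply/orP; right; apply/allpairsP; exists (j, (L k)`_i).
  by rewrite /= mem_enum mem_nth.
suff VM : forall x y, V y -> V (x * y).
  move=> x; rewrite -[x]mulr1; apply: VM; exists 0%N.
  by apply: mem_in_span; rewrite inE.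
apply: gP => //; split=> [k y [i yi]|x x' hx hx' y hy|x x' hx hx' y hy].
- by exists i; rewrite mulr_algl; apply: in_spanZ.
- by rewrite mulrDl; apply: VD; [apply: hx|apply: hx'].
- by rewrite -mulrA; apply: hx; apply: hx'.
Qed.

(** An uncountable type cannot be a countable union of finite fibres. *)
Lemma countable_fibre (T : choiceType) (n : T -> nat) (d : nat -> nat) :
    ~ countable [set: T]%classic ->
  exists k (c : 'I_(d k) -> T), injective c /\ forall i, n (c i) = k.
Proof.
move=> ncT.
have [k infk] : exists k, infinite_set [set c | n c = k].
  apply: contrapT => /forallNP fin; apply: ncT.
  have -> : [set: T]%classic = (\bigcup_(k in [set: nat]) [set c | n c = k])%classic.
    by apply/seteqP; split=> // c _; exists (n c).
  apply: bigcup_countable => // k _; apply: finite_set_countable.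
  apply: contrapT. exact: fin.
have [B Bk sB] := infinite_set_fset (d k) infk.
have lt_i (i : 'I_(d k)) : (i < size B)%N by apply: leq_trans sB.
exists k, (fun i => tnth (in_tuple B) (Ordinal (lt_i i))); split=> [i j|i].
  have /tuple_uniqP injB : uniq (in_tuple B) by exact: fset_uniq.
  by move=> /injB /(congr1 val) /= ij; apply: val_inj.
by apply: Bk; apply: (mem_tnth _ (in_tuple B)).
Qed.

Section Nullstellensatz.
Variables (K : closedFieldType) (O : comAlgType K).
Hypothesis uncountableK : ~ countable [set: K]%classic.
Hypothesis fgO : finitely_generated_algebra O.

(** Invertibility in the quotient ring [O / I]. *)
Definition unit_mod (I : O -> Prop) (t : O) : Prop := exists h, I (h * t - 1).

Section UnitMod.
Variable I : O -> Prop.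
Hypothesis II : ideal_set I.

Lemma ideal_setN x : I x -> I (- x).
Proof. by case: II => _ _ IM Ix; rewrite -mulN1r; apply: IM. Qed.

Lemma ideal_setB x y : I x -> I y -> I (x - y).
Proof. by case: II => _ ID _ Ix Iy; apply: ID => //; apply: ideal_setN. Qed.

Lemma ideal_setZ (k : K) x : I x -> I (k *: x).
Proof. by case: II => _ _ IM Ix; rewrite scale_in_alg; apply: IM. Qed.

Lemma unit_modM x y : unit_mod I x -> unit_mod I y -> unit_mod I (x * y).
Proof.
case: II => I0 ID IM [h hx] [k ky]; exists (h * k).
have -> : h * k * (x * y) - 1 = (k * y) * (h * x - 1) + (k * y - 1) by ring.
by apply: ID => //; apply: IM.
Qed.

Lemma unit_mod_horner t (q : {poly K}) : q != 0 ->
  (forall c : K, unit_mod I (t - c%:A)) -> unit_mod I (horner_alg t q).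
Proof.
move=> q0 ht; case: II => I0 _ _; have [r ->] := closed_field_poly_normal q.
rewrite -mul_polyC rmorphM /= horner_algC; apply: unit_modM.
  exists (lead_coef q)^-1%:A.
  suff e : (lead_coef q)^-1%:A * (lead_coef q)%:A - 1 = 0 :> O by rewrite e.
  by rewrite mulr_algl scalerA mulVf ?lead_coef_eq0 // scale1r subrr.
elim: r => [|z r IH].
  by rewrite big_nil rmorph1; exists 1; rewrite mulr1 subrr.
rewrite big_cons rmorphM; apply: unit_modM => //.
by rewrite rmorphB /= horner_algX horner_algC.
Qed.

(** If [t - c] had an inverse [h c] modulo [I] for all scalars [c], then the
uncountably many [h c] would be spread over the countably many finite-dimensional
spaces spanned by the [L k]. Some of these contains more [h c] than its
dimension, and a linear relation between them, multiplied by all the factors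
[t - c], gives a nonzero polynomial [q] with [q(t)] in [I]. But [q(t)] is invertible
modulo [I], as [q] splits into linear factors. *)
Lemma exists_eigenvalue_mod t : ~ I 1 ->
  exists c : K, ~ unit_mod I (t - c%:A).
Proof.
move=> nI1; apply: contrapT => /forallNP hc.
have ht c : unit_mod I (t - c%:A) by apply: contrapT; apply: hc.
have [L hL] := countably_spanned fgO.
have [h hP] := choice ht; have [n hn] := choice (fun c => hL (h c)).
have [k [c [injc nc]]] := countable_fibre n (fun k => (size (L k)).+1) uncountableK.
have [i|v [i0 vi0] vh] := @in_span_dependent _ _ (L k) (fun i => h (c i)).
  by rewrite -(nc i).
pose d := (size (L k)).+1.
pose q : {poly K} := \sum_(i < d) v i *: \prod_(j < d | j != i) ('X - (c j)%:P).
have q0 : q != 0.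
  apply/eqP => /(congr1 (horner^~ (c i0))); rewrite horner0 /q horner_sum.
  (* At the root [c i0] only the term without the factor 'X - c i0 survives. *)
  rewrite (bigD1 i0) //= [X in _ + X]big1 => [|i ii0].
    rewrite addr0 hornerZ horner_prod => /eqP; rewrite mulf_eq0 (negPf vi0) /=.
    move=> /prodf_eq0[j ji0]; rewrite !hornerE subr_eq0 => /eqP /injc ji.
    by rewrite ji eqxx in ji0.
  rewrite hornerZ horner_prod (bigD1 i0) 1?eq_sym //=.
  by rewrite hornerXsubC subrr mul0r mulr0.
have [e he] := unit_mod_horner q0 ht.
case: (II) => I0 ID IM; apply: nI1.
have Iq : I (horner_alg t q).
  pose w := \prod_(j < d) (t - (c j)%:A).
  have -> : horner_alg t q = - \sum_(i < d)
      (v i *: (\prod_(j < d | j != i) (t - (c j)%:A)) * (h (c i) * (t - (c i)%:A) - 1)).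
    apply/eqP; rewrite -addr_eq0 /q rmorph_sum -big_split /=; apply/eqP.
    transitivity (w * \sum_(i < d) v i *: h (c i)); last by rewrite vh mulr0.
    rewrite [RHS]mulr_sumr; apply: eq_bigr => i _.
    rewrite linearZ rmorph_prod /=.
    under eq_bigr do rewrite rmorphB /= horner_algX horner_algC.
    have -> : w = (t - (c i)%:A) * \prod_(j < d | j != i) (t - (c j)%:A).
      by rewrite /w (bigD1 i).
    by move: (\prod_(j < d | _) _) => y; rewrite !scale_in_alg; ring.
  apply: ideal_setN; elim/big_rec: _ => // i x _ Ix.
  by apply: ID => //; apply: IM.
rewrite -[1](subKr (e * horner_alg t q)); apply: ideal_setB => //.
exact: IM.
Qed.

End UnitMod.

(** A generator [t] can be made equal to a scalar [c] by adding [t - c] to the ideal,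
which stays proper when [t - c] is not invertible modulo it. After all
generators have been treated, [O] is the sum of the scalars and a proper ideal. *)
Theorem exists_point_of_proper_ideal (I : O -> Prop) : ideal_set I -> ~ I 1 ->
  exists p : {lrmorphism O -> K^o}, forall x, I x -> p x = 0.
Proof.
move=> II nI1; have /finitely_generatedP[n [g gP]] := fgO.
have [J [JI nJ1 IJ Jg]] : exists J, [/\ ideal_set J, ~ J 1,
    forall x, I x -> J x & forall i, exists c : K, J (g i - c%:A)].
  suff /(_ n) [J [JI nJ1 IJ Jg]] : forall k, exists J, [/\ ideal_set J, ~ J 1,
      forall x, I x -> J x &
      forall i : 'I_n, (i < k)%N -> exists c : K, J (g i - c%:A)].
    by exists J; split=> // i; apply: Jg.
  elim=> [|k [J [JI nJ1 IJ Jg]]]; first by exists I.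
  have [kn|nk] := ltnP k n; last first.
    by exists J; split=> // i _; apply: Jg; apply: leq_trans (ltn_ord i) nk.
  pose t := g (Ordinal kn); have [c ntc] := exists_eigenvalue_mod JI t nJ1.
  case: (JI) => J0 JD JM.
  exists (fun y => exists a, J (y - a * (t - c%:A))); split.
  - split; first by exists 0; rewrite mul0r subr0.
      move=> x y [a Ja] [b Jb]; exists (a + b).
      by rewrite mulrDl opprD addrACA; apply: JD.
    by move=> e x [a Ja]; exists (e * a); rewrite -mulrA -mulrBr; apply: JM.
  - move=> [a Ja]; apply: ntc; exists a.
    by rewrite -opprB; apply: ideal_setN.
  - by move=> x Ix; exists 0; rewrite mul0r subr0; apply: IJ.
  - move=> i; rewrite ltnS leq_eqVlt => /predU1P[ik|/Jg[e Je]]; last first.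
      by exists e, 0; rewrite mul0r subr0.
    exists c, 1; rewrite mul1r (_ : i = Ordinal kn) ?subrr //.
    exact: val_inj.
case: (JI) => J0 JD JM.
have JMc x x' (c : K) y : J (x - c%:A) -> J (y - x'%:A) -> J (x * y - (c * x')%:A).
  move=> hx hy.
  have -> : x * y - (c * x')%:A = y * (x - c%:A) + c%:A * (y - x'%:A).
    rewrite !scale_in_alg rmorphM; ring.
  by apply: JD; apply: JM.
have /choice[p pP] : forall x, exists c : K, J (x - c%:A).
  apply: gP => //; split=> [k|x y [c Jc] [e Je]|x y [c Jc] [e Je]].
  - by exists k; rewrite subrr.
  - by exists (c + e); rewrite scalerDl opprD addrACA; apply: JD.
  - by exists (c * e); apply: JMc.
have puniq x (c : K) : J (x - c%:A) -> p x = c.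
  move=> hx; apply/eqP; rewrite -subr_eq0; apply/negPn/negP => pc; apply: nJ1.
  rewrite -(scale1r 1) -(mulVf pc) -scalerA; apply: ideal_setZ => //.
  have -> : (p x - c)%:A = (x - c%:A) - (x - (p x)%:A) :> O.
    by rewrite scalerBl; ring.
  exact: ideal_setB.
have [|||P PE] := @lrmorphism_of K O K^o p.
- move=> k x y; apply: puniq; rewrite scalerDl opprD addrACA; apply: JD => //.
  by rewrite -scalerA -scalerBr; apply: ideal_setZ.
- by apply: puniq; rewrite scale1r subrr.
- by move=> x y; apply: puniq; apply: JMc.
exists P => x Ix; rewrite PE; apply: puniq; rewrite scale0r subr0.
exact: IJ.
Qed.

End Nullstellensatz.

(** * Derivations and reducedness *)

Section Derivations.
Variables (K : fieldType) (O : comAlgType K).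
Hypothesis charK : [pchar K] =i pred0.

Definition derivation (D : O -> O) : Prop :=
  (forall x y, D (x + y) = D x + D y) /\
  (forall x y, D (x * y) = x * D y + D x * y).

(** Tangent vectors at the point [p]. *)
Definition point_derivation (p : {lrmorphism O -> K^o}) (w : O -> K^o) : Prop :=
  linear w /\ forall x y, w (x * y) = p x * w y + w x * p y.

Lemma mulrn_pchar0 n (x : O) : x *+ n.+1 = 0 -> x = 0.
Proof.
rewrite -scaler_nat => /eqP; rewrite scaler_eq0.
by have /pcharf0P-> := charK; move=> /eqP.
Qed.

Section OneDerivation.
Variable D : O -> O.
Hypothesis derD : derivation D.

Lemma derivation0 : D 0 = 0.
Proof. by apply: (addrI (D 0)); rewrite -derD.1 !addr0. Qed.

Lemma derivation1 : D 1 = 0.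
Proof. by apply: (addrI (D 1)); rewrite addr0 -{3}[1]mulr1 derD.2 mul1r mulr1. Qed.

Lemma derivation_exp x n : D (x ^+ n.+1) = (x ^+ n * D x) *+ n.+1.
Proof.
elim: n => [|n IH]; first by rewrite expr0 mul1r.
by rewrite exprS derD.2 IH exprS !mulrSr; ring.
Qed.

(** Applying [D] to [x^(j+1) (D x)^i = 0] and multiplying by [D x] gives
[(j+1) x^j (D x)^(i+2) = 0]; characteristic zero allows one to divide by [j+1] and
to descend until no factor [x] is left. *)
Lemma derivation_nilpotent x n : x ^+ n = 0 -> exists k, D x ^+ k = 0.
Proof.
suff gen j i : x ^+ j * D x ^+ i = 0 -> exists k, D x ^+ k = 0.
  by move=> xn; apply: (gen n 0%N); rewrite xn mul0r.
elim: j i => [|j IH] i h; first by exists i; rewrite -h mul1r.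
apply: (IH i.+2); apply: (@mulrn_pchar0 j).
have := congr1 (fun y => D x * D y) h.
rewrite derivation0 mulr0 derD.2 derivation_exp => h'.
have -> : (x ^+ j * D x ^+ i.+2) *+ j.+1 =
   D x * ((x ^+ j * D x) *+ j.+1 * D x ^+ i).
  by rewrite mulrnAl mulrnAr; congr (_ *+ _); rewrite !exprS; ring.
case: i h h' => [|i] h h'.
  by move: h'; rewrite expr0 derivation1 mulr0 add0r.
move: h'; rewrite derivation_exp mulrDr.
suff -> : D x * (x ^+ j.+1 * ((D x ^+ i * D (D x)) *+ i.+1)) = 0 by rewrite add0r.
have -> : D x * (x ^+ j.+1 * ((D x ^+ i * D (D x)) *+ i.+1)) =
    (x ^+ j.+1 * D x ^+ i.+1 * D (D x)) *+ i.+1.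
  by rewrite !mulrnAr; congr (_ *+ _); rewrite [D x ^+ i.+1]exprS; ring.
by rewrite h mul0r mul0rn.
Qed.

End OneDerivation.

Section CotangentFrame.
Variable p : {lrmorphism O -> K^o}.
Hypothesis fgO : finitely_generated_algebra O.
Let m := point_ideal p.
Let mI : ideal_set m := point_ideal_set p.
Let m2 := ideal_power m 2.

(** The classes of the [x i] span the cotangent space [m / m^2]. *)
Definition spans_cotangent r (x : 'I_r -> O) : Prop :=
  (forall i, p (x i) = 0) /\
  forall y, exists c : 'I_r -> K, m2 (y - (p y)%:A - \sum_i c i *: x i).

Lemma m2Z k x : m2 x -> m2 (k *: x).
Proof. by move=> hx; rewrite -mulr_algl; apply: ideal_power_mull. Qed.

(** The Leibniz rule for the class of [y - p y] modulo [m^2]. *)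
Lemma cotangentM y z s t : m2 (y - (p y)%:A - s) -> m2 (z - (p z)%:A - t) ->
  m2 (y * z - (p (y * z))%:A - ((p y : K) *: t + (p z : K) *: s)).
Proof.
move=> hy hz.
have -> : y * z - (p (y * z))%:A - ((p y : K) *: t + (p z : K) *: s) =
    (y - (p y)%:A) * (z - (p z)%:A) + (p y : K) *: (z - (p z)%:A - t)
    + (p z : K) *: (y - (p y)%:A - s).
  by rewrite pointM -scalerA !scale_in_alg; ring.
apply: ideal_power_D; last exact: m2Z.
apply: ideal_power_D; last exact: m2Z.
apply: ideal_power_M; first exact: sub_point.
by apply/(ideal_power1 mI); apply: sub_point.
Qed.

Lemma exists_spans_cotangent : exists r (x : 'I_r -> O), spans_cotangent x.
Proof.
have /finitely_generatedP[n [g gP]] := fgO.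
exists n, (fun i => g i - (p (g i))%:A); split; first by move=> i; apply: sub_point.
apply: gP => [|j]; last first.
  exists (fun i => (i == j)%:R); rewrite (bigD1 j) //= eqxx scale1r.
  rewrite big1 => [|i /negPf ->]; last by rewrite scale0r.
  by rewrite addr0 subrr; apply: ideal_power_0.
split=> [k|y z [c hc] [e he]|y z [c hc] [e he]].
- exists (fun=> 0); rewrite big1 => [|i _]; last by rewrite scale0r.
  by rewrite point_scalar !subrr; apply: ideal_power_0.
- exists (fun i => c i + e i); rewrite pointD scalerDl.
  under eq_bigr do rewrite scalerDl.
  rewrite big_split /=.
  have -> : forall s t u v : O, y + z - (u + v) - (s + t) =
      (y - u - s) + (z - v - t) by move=> s t u v; ring.
  exact: ideal_power_D.
- exists (fun i => (p y : K) * e i + (p z : K) * c i).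
  under eq_bigr do rewrite scalerDl -!scalerA.
  by rewrite big_split /= -!scaler_sumr; apply: cotangentM.
Qed.

(** A basis [x] of [m / m^2] with its dual basis [w] of the tangent space. A spanning
family of minimal length is free modulo [m^2], so the coordinates of [y - p y]
are unique, and uniqueness makes them linear in [y] and subject to the Leibniz
rule. *)
Lemma cotangent_frame : exists r (x : 'I_r -> O) (w : 'I_r -> O -> K^o),
  [/\ forall i, p (x i) = 0, forall i, point_derivation p (w i)
    & forall y, p y = 0 -> m2 (y - \sum_i w i y *: x i)].
Proof.
pose Q r := `[< exists x : 'I_r -> O, spans_cotangent x >].
have exQ : exists r, Q r.
  by have [r [x hx]] := exists_spans_cotangent; exists r; apply/asboolP; exists x.
case: (ex_minnP exQ) => r /asboolP[x [px xspan]] rmin.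
have free (c : 'I_r -> K) : m2 (\sum_i c i *: x i) -> forall i, c i = 0.
  move=> hc j; apply: contrapT => /eqP cj.
  case: r x px xspan rmin c hc j cj => [|r] x px xspan rmin c hc j cj.
    by case: j cj.
  suff /rmin : Q r by rewrite ltnn.
  apply/asboolP; exists (fun i : 'I_r => x (lift j i)); split; first by move=> i; apply: px.
  move=> y; have [e he] := xspan y.
  pose f i := e i - e j / c j * c i.
  exists (fun i : 'I_r => f (lift j i)).
  suff -> : \sum_(i < r) f (lift j i) *: x (lift j i) =
      \sum_i e i *: x i - (e j / c j) *: \sum_i c i *: x i.
    rewrite opprB addrA addrAC; apply: ideal_power_D => //; exact: m2Z.
  transitivity (\sum_i f i *: x i).
    by rewrite [RHS](bigD1_ord j) //= /f divfK // subrr scale0r add0r.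
  rewrite /f; under eq_bigr do rewrite scalerBl -scalerA.
  by rewrite big_split /= sumrN -scaler_sumr.
have /choice[c cP] := xspan.
have cuniq y (e : 'I_r -> K) :
    m2 (y - (p y)%:A - \sum_i e i *: x i) -> forall i, c y i = e i.
  move=> he i; apply/eqP; rewrite -subr_eq0; apply/eqP; move: i; apply: free.
  under eq_bigr do rewrite scalerBl.
  rewrite big_split /= sumrN.
  have subE : forall s t Y : O, s - t = (Y - t) - (Y - s) by move=> s t Y; ring.
  by rewrite (subE _ _ (y - (p y)%:A)); apply: ideal_powerB => //; apply: cP.
exists r, x, (fun i y => c y i); split=> //; last first.
  by move=> y py; have := cP y; rewrite py scale0r subr0.
move=> i; split=> [k y z|y z].
  move: i; apply: (cuniq _ (fun i => k * c y i + c z i)).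
  under eq_bigr do rewrite scalerDl -scalerA.
  rewrite big_split /= -scaler_sumr.
  have -> : forall s t : O, k *: y + z - (p (k *: y + z))%:A - (k *: s + t) =
      k *: (y - (p y)%:A - s) + (z - (p z)%:A - t).
    move=> s t; have -> : p (k *: y + z) = k * (p y : K) + (p z : K) :> K.
      by rewrite linearP.
    by rewrite scalerDl -scalerA !scale_in_alg; ring.
  by apply: ideal_power_D; [apply: m2Z|]; apply: cP.
move: i; apply: (cuniq _ (fun i => (p y : K) * c z i + c y i * (p z : K))).
under eq_bigr do rewrite scalerDl [c y _ * _]mulrC -!scalerA.
by rewrite big_split /= -!scaler_sumr; apply: cotangentM; apply: cP.
Qed.

(** Euler's identity: a derivation that is the identity on [m / m^2] acts on
[m^n / m^(n+1)] as multiplication by [n]. *)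
Lemma euler_eigenvalue E n a : derivation E -> (forall x, p (E x) = 0) ->
    (forall x, p x = 0 -> m2 (x - E x)) ->
  ideal_power m n a -> ideal_power m n.+1 (a *+ n - E a).
Proof.
move=> dE pE Em; elim=> {n a} [x|n|n x y _ hx _ hy|n x y mx hy IH].
- by rewrite mulr0n sub0r; apply: ideal_powerN => //; apply/(ideal_power1 mI); apply: pE.
- by rewrite mul0rn (derivation0 dE) subr0; apply: ideal_power_0.
- by rewrite mulrnDl dE.1 opprD addrACA; apply: ideal_power_D.
- have -> : (x * y) *+ n.+1 - E (x * y) = x * (y *+ n - E y) + (x - E x) * y.
    by rewrite dE.2 mulrSr -mulrnAr; ring.
  apply: ideal_power_D; first exact: ideal_power_M.
  by rewrite -add2n; apply: ideal_powerM => //; apply: Em.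
Qed.

(** With [E] the Euler field of a frame, [n a - E a] is in [m^(n+1)] for [a] in [m^n].
When [a] is nilpotent so are the [D i a], hence they too are in [m^n], and [E a],
a combination of them with coefficients in [m], is in [m^(n+1)]. Hence so is [n a]. *)
Lemma nilpotent_ideal_power :
    (forall w, point_derivation p w ->
       exists2 D, derivation D & forall x, p (D x) = w x) ->
  forall n a k, a ^+ k = 0 -> ideal_power m n a.
Proof.
move=> lift_der.
have [r [x [w [px wder xw]]]] := cotangent_frame.
have /choice[D DP] : forall i, exists D, derivation D /\ forall y, p (D y) = w i y.
  by move=> i; have [D dD Dw] := lift_der _ (wder i); exists D.
pose E y := \sum_i x i * D i y.
have dE : derivation E.
  split=> y z; rewrite /E.
    by rewrite -big_split; apply: eq_bigr => i _; rewrite (DP i).1.1 mulrDr.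
  rewrite mulr_sumr mulr_suml -big_split; apply: eq_bigr => i _.
  by rewrite (DP i).1.2 /=; ring.
have pE y : p (E y) = 0.
  by rewrite rmorph_sum big1 // => i _; rewrite rmorphM /= px mul0r.
have Em y : p y = 0 -> m2 (y - E y).
  move=> py.
  have -> : y - E y = (y - \sum_i w i y *: x i) -
      \sum_i x i * (D i y - (p (D i y))%:A).
    rewrite -addrA -opprD; congr (_ - _); rewrite -big_split; apply: eq_bigr => i _.
    by rewrite (DP i).2 /= !scale_in_alg; ring.
  apply: ideal_powerB => //; first exact: xw.
  apply: ideal_power_sum => // i _; apply: ideal_power_M; first exact: px.
  by apply/(ideal_power1 mI); apply: sub_point.
elim=> [|n IH] a k ak; first exact: ideal_power_all.
(* From m^0 to m the factor n is 0 and gives nothing; that step holds because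
   a nilpotent vanishes at [p]. *)
case: n IH => [|n] IH.
  apply/(ideal_power1 mI); apply/eqP.
  have : (p a : K) ^+ k = 0 by rewrite -[LHS](rmorphXn p) ak rmorph0.
  by move/eqP; rewrite expf_eq0 => /andP[].
have hEa : ideal_power m n.+2 (E a).
  apply: ideal_power_sum => // i _; apply: ideal_power_M; first exact: px.
  by have [j hj] := derivation_nilpotent (DP i).1 ak; apply: IH hj.
have := euler_eigenvalue dE pE Em (IH _ _ ak).
move=> /ideal_power_D/(_ hEa); rewrite subrK -scaler_nat => h.
have n0 : n.+1%:R != 0 :> K by have /pcharf0P-> := charK.
rewrite -[a]scale1r -(mulVf n0) -scalerA -mulr_algl.
exact: ideal_power_mull.
Qed.

End CotangentFrame.
End Derivations.

(** If a nilpotent [a] is nonzero, then its annihilator vanishes at some point [p].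
As [a] lies in all powers of the ideal of [p], Krull's theorem gives [a = z * a] with
[p z = 0], and [1 - z] is in the annihilator but takes the value 1 at [p]. *)
Theorem reduced_of_lifted_derivations (K : closedFieldType) (O : comAlgType K) :
    [pchar K] =i pred0 -> ~ countable [set: K]%classic ->
    finitely_generated_algebra O ->
    (forall (p : {lrmorphism O -> K^o}) w, point_derivation p w ->
       exists2 D, derivation D & forall x, p (D x) = w x) ->
  reduced O.
Proof.
move=> charK uncK fgO lift_der a k ak.
pose ann (x : O) := x * a = 0.
apply: contrapT => a0.
have annI : ideal_set ann.
  rewrite /ann; split=> [|x y hx hy|b x hx]; first by rewrite mul0r.
    by rewrite mulrDl hx hy addr0.
  by rewrite -mulrA hx mulr0.
have [|p hp] := exists_point_of_proper_ideal uncK fgO annI.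
  by rewrite /ann mul1r.
have hpow n := nilpotent_ideal_power charK fgO (lift_der p) n ak.
have [z pz az] := krull_intersection fgO hpow.
have /hp : ann (1 - z) by rewrite /ann mulrBl mul1r -az subrr.
rewrite rmorphB rmorph1 /= pz subr0 => /eqP; apply/negP; exact: oner_neq0.
Qed.

(** * Quotients of superalgebras *)

Record properIdeal (K : fieldType) (A : algType K) := MakeProperIdeal {
  ideal_pred :> {pred A};
  ideal_predP : ideal_closed ideal_pred;
  ideal_proper : 1 \notin ideal_pred
}.

Section QuotientAlgebra.
Variables (K : fieldType) (A : algType K) (I : properIdeal A).

Fact ideal_zmod_closed : zmod_closed (I : {pred A}).
Proof.
have [I0 ID IM _] := ideal_predP I; split=> // x y Ix Iy.
by apply: ID => //; rewrite -mulN1r; apply: IM.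
Qed.
HB.instance Definition _ :=
  GRing.isZmodClosed.Build A (ideal_pred I) ideal_zmod_closed.

Definition quotientAlg := Quotient.quot (ideal_pred I).
HB.instance Definition _ := GRing.Zmodule.on quotientAlg.

Definition quotient_pi (x : A) : quotientAlg := (\pi_(Quotient.quot (ideal_pred I)) x)%qT.
Definition quotient_repr (x : quotientAlg) : A := repr (x : Quotient.quot (ideal_pred I)).
Local Notation pi := quotient_pi.
Local Notation rep := quotient_repr.

Lemma quotient_reprK : cancel rep pi.
Proof. by move=> x; rewrite /pi /rep reprK. Qed.

Lemma quotient_piP x y : pi x = pi y <-> x - y \in I.
Proof. by rewrite Quotient.idealrBE; split=> /eqP. Qed.

Lemma quotient_pi0P x : pi x = 0 <-> x \in I.
Proof.
have -> : (0 : quotientAlg) = pi 0 by rewrite [RHS]raddf0.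
by rewrite quotient_piP subr0.
Qed.

Lemma quotient_surj (x : quotientAlg) : exists y, x = pi y.
Proof. by exists (rep x); rewrite quotient_reprK. Qed.

Lemma rep_pi x : rep (pi x) - x \in I.
Proof. by apply/quotient_piP; rewrite quotient_reprK. Qed.

Lemma quotient_piD x y : pi (x + y) = pi x + pi y.
Proof. exact: raddfD. Qed.

Definition quotient_one : quotientAlg := pi 1.
Definition quotient_mul (x y : quotientAlg) : quotientAlg := pi (rep x * rep y).
Definition quotient_scale (k : K) (x : quotientAlg) : quotientAlg := pi (k *: rep x).

Lemma quotient_piM x y : pi (x * y) = quotient_mul (pi x) (pi y).
Proof.
have [_ ID IM IMr] := ideal_predP I.
apply/esym/quotient_piP.
have -> : rep (pi x) * rep (pi y) - x * y =
    rep (pi x) * (rep (pi y) - y) + (rep (pi x) - x) * y.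
  by rewrite mulrBr mulrBl addrA subrK.
by apply: ID; [apply: IM|apply: IMr]; exact: rep_pi.
Qed.

Lemma quotient_piZ k x : pi (k *: x) = quotient_scale k (pi x).
Proof.
have [_ _ IM _] := ideal_predP I.
apply/esym/quotient_piP; rewrite -scalerBr -mulr_algl; apply: IM.
exact: rep_pi.
Qed.

Fact quotient_mulA : associative quotient_mul.
Proof.
move=> x y z; have [[x' ->] [y' ->] [z' ->]] :=
  And3 (quotient_surj x) (quotient_surj y) (quotient_surj z).
by rewrite -!quotient_piM mulrA.
Qed.

Fact quotient_mul1 : left_id quotient_one quotient_mul.
Proof. by move=> x; have [x' ->] := quotient_surj x; rewrite -quotient_piM mul1r. Qed.

Fact quotient_mulr1 : right_id quotient_one quotient_mul.
Proof. by move=> x; have [x' ->] := quotient_surj x; rewrite -quotient_piM mulr1. Qed.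

Fact quotient_mulDl : left_distributive quotient_mul +%R.
Proof.
move=> x y z; have [[x' ->] [y' ->] [z' ->]] :=
  And3 (quotient_surj x) (quotient_surj y) (quotient_surj z).
by rewrite -quotient_piD -!quotient_piM mulrDl quotient_piD.
Qed.

Fact quotient_mulDr : right_distributive quotient_mul +%R.
Proof.
move=> x y z; have [[x' ->] [y' ->] [z' ->]] :=
  And3 (quotient_surj x) (quotient_surj y) (quotient_surj z).
by rewrite -quotient_piD -!quotient_piM mulrDr quotient_piD.
Qed.

Fact quotient_one_neq0 : quotient_one != 0.
Proof. by apply/eqP => /quotient_pi0P I1; case/negP: (ideal_proper I). Qed.

HB.instance Definition _ := GRing.Zmodule_isNzRing.Build quotientAlg
  quotient_mulA quotient_mul1 quotient_mulr1 quotient_mulDl quotient_mulDr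
  quotient_one_neq0.

Fact quotient_scaleA k l x :
  quotient_scale k (quotient_scale l x) = quotient_scale (k * l) x.
Proof. by have [x' ->] := quotient_surj x; rewrite -!quotient_piZ scalerA. Qed.

Fact quotient_scale1 : left_id 1 quotient_scale.
Proof. by move=> x; have [x' ->] := quotient_surj x; rewrite -quotient_piZ scale1r. Qed.

Fact quotient_scaleDr : right_distributive quotient_scale +%R.
Proof.
move=> k x y; have [[x' ->] [y' ->]] := conj (quotient_surj x) (quotient_surj y).
by rewrite -quotient_piD -!quotient_piZ scalerDr quotient_piD.
Qed.

Fact quotient_scaleDl x : {morph quotient_scale^~ x : k l / k + l}.
Proof.
move=> k l; have [x' ->] := quotient_surj x.
by rewrite -!quotient_piZ scalerDl quotient_piD.
Qed.

HB.instance Definition _ := GRing.Zmodule_isLmodule.Build K quotientAlg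
  quotient_scaleA quotient_scale1 quotient_scaleDr quotient_scaleDl.

Fact quotient_scaleAl (k : K) (x y : quotientAlg) : k *: (x * y) = k *: x * y.
Proof.
have [[x' ->] [y' ->]] := conj (quotient_surj x) (quotient_surj y).
change (quotient_scale k (quotient_mul (pi x') (pi y')) =
        quotient_mul (quotient_scale k (pi x')) (pi y')).
by rewrite -!(quotient_piM, quotient_piZ) scalerAl.
Qed.

HB.instance Definition _ :=
  GRing.Lmodule_isLalgebra.Build K quotientAlg quotient_scaleAl.

Fact quotient_scaleAr (k : K) (x y : quotientAlg) : k *: (x * y) = x * (k *: y).
Proof.
have [[x' ->] [y' ->]] := conj (quotient_surj x) (quotient_surj y).
change (quotient_scale k (quotient_mul (pi x') (pi y')) =
        quotient_mul (pi x') (quotient_scale k (pi y'))).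
by rewrite -!(quotient_piM, quotient_piZ) scalerAr.
Qed.

HB.instance Definition _ :=
  GRing.Lalgebra_isAlgebra.Build K quotientAlg quotient_scaleAr.

Fact quotient_pi_linear : linear pi.
Proof. by move=> k x y; rewrite quotient_piD quotient_piZ. Qed.
HB.instance Definition _ :=
  GRing.isLinear.Build K A quotientAlg *:%R quotient_pi quotient_pi_linear.

Fact quotient_pi_monoid : monoid_morphism pi.
Proof. by split=> // x y; apply: quotient_piM. Qed.
HB.instance Definition _ :=
  GRing.isMonoidMorphism.Build A quotientAlg quotient_pi quotient_pi_monoid.

Lemma commutative_quotient : (forall x y, x * y - y * x \in I) ->
  exists (O : comAlgType K) (q : {lrmorphism A -> O}),
    (forall y, exists x, q x = y) /\ (forall x, q x = 0 <-> x \in I).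
Proof.
move=> commI.
have mulC : commutative (@GRing.mul quotientAlg).
  move=> x y; have [[x' ->] [y' ->]] := conj (quotient_surj x) (quotient_surj y).
  by rewrite -!rmorphM; apply/quotient_piP.
pose mC := GRing.PzRing_hasCommutativeMul.Build quotientAlg mulC.
pose O : comAlgType K := HB.pack_for (comAlgType K) quotientAlg mC.
exists O, quotient_pi; split; last exact: quotient_pi0P.
by move=> y; have [x ->] := quotient_surj y; exists x.
Qed.

End QuotientAlgebra.

Lemma homogN (K : fieldType) (A : superAlgType K) i (x : A) :
  x \in homog i -> - x \in homog i.
Proof.
have [h0 hZ] := homog_submod (s := A) i.
by move=> hx; rewrite -scaleN1r -[_ *: x]addr0; apply: hZ.
Qed.

(** For a parity-preserving map this is plain surjectivity
([homog_surjectiveW]); stated by parity it gives odd lifts of odd elements. *)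
Definition homog_surjective (K : fieldType) (A H : superAlgType K)
    (q : A -> H) : Prop :=
  forall i y, y \in homog i -> exists2 x, x \in homog i & q x = y.

Lemma homog_surjectiveW (K : fieldType) (A H : superAlgType K)
  (q : {superhom A -> H}) : homog_surjective q -> forall y, exists x, q x = y.
Proof.
move=> q_homog y; have [y0 [y1 [/q_homog[x0 _ <-] /q_homog[x1 _ <-] ->]]] := homog_split y.
by exists (x0 + x1); rewrite rmorphD.
Qed.

(** An ideal that contains the homogeneous parts of its elements has a quotient
that is graded by the images of the homogeneous elements. *)
Lemma super_quotient (K : fieldType) (A : superAlgType K) (I : properIdeal A) :
    (forall x0 x1, x0 \in homog false -> x1 \in homog true -> x0 + x1 \in I ->
       x0 \in I /\ x1 \in I) ->
  exists (H : superAlgType K) (q : {superhom A -> H}),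
    homog_surjective q /\ (forall x, q x = 0 <-> x \in I).
Proof.
move=> homogI; pose Q := quotientAlg I; pose pi : A -> Q := @quotient_pi _ _ I.
have [I0 ID IM IMr] := ideal_predP I.
pose h i : {pred Q} := [pred x | `[< exists2 y, y \in homog i & x = pi y >] ].
have hE i x : (x \in h i) = `[< exists2 y, y \in homog i & x = pi y >] by [].
have h_pi i x : x \in homog i -> pi x \in h i.
  by move=> hx; rewrite hE; apply/asboolP; exists x.
have hP i x : x \in h i -> exists2 y, y \in homog i & x = pi y.
  by rewrite hE => /asboolP.
have A_sub i := homog_submod (s := A) i.
have h_submod i : submod_closed (h i).
  split=> [|k x y /hP[x' hx ->] /hP[y' hy ->]].
    by rewrite -(rmorph0 pi); apply: h_pi; case: (A_sub i).
  by rewrite -linearP; apply: h_pi; case: (A_sub i) => _; apply.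
have h_disj x : x \in h false -> x \in h true -> x = 0.
  move=> /hP[y hy ->] /hP[z hz] /quotient_piP yz; apply/quotient_pi0P.
  by have [] := homogI y (- z) hy (homogN hz) yz.
have h_split x : exists x0 x1, [/\ x0 \in h false, x1 \in h true & x = x0 + x1].
  have [y ->] := quotient_surj x; have [y0 [y1 [h0 h1 ->]]] := homog_split y.
  by exists (pi y0), (pi y1); split; rewrite ?h_pi // -rmorphD.
have h1 : 1 \in h false by rewrite -(rmorph1 pi); apply: h_pi; exact: homog1.
have hM i j x y : x \in h i -> y \in h j -> x * y \in h (i (+) j).
  move=> /hP[x' hx ->] /hP[y' hy ->]; rewrite -rmorphM; apply: h_pi.
  exact: homogM.
have hC i j x y : x \in h i -> y \in h j -> x * y = (-1) ^+ (i && j) * (y * x).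
  move=> /hP[x' hx ->] /hP[y' hy ->]; rewrite -!rmorphM (supercomm i j x' y' hx hy).
  by case: (i && j); rewrite ?expr1 ?expr0 ?mulN1r ?mul1r ?rmorphN.
pose m := isSuperAlgebra.Build K Q h_submod h_disj h_split h1 hM hC.
pose H : superAlgType K := HB.pack_for (superAlgType K) Q m.
pose q : {superhom A -> H} := @SuperHom K A H pi h_pi.
exists H, q; split; last exact: quotient_pi0P.
by move=> i y /hP[x hx ->]; exists x.
Qed.

Lemma kernel_ideal_closed (A B : nzRingType) (f : {rmorphism A -> B}) :
  ideal_closed [pred x | f x == 0].
Proof.
split; first by rewrite inE rmorph0.
- by move=> x y; rewrite !inE rmorphD /= => /eqP-> /eqP->; rewrite addr0.
- by move=> a x; rewrite !inE rmorphM /= => /eqP->; rewrite mulr0.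
- by move=> a x; rewrite !inE rmorphM /= => /eqP->; rewrite mul0r.
Qed.

Lemma in_odd_ideal_kernel (K : fieldType) (A : superAlgType K) (B : nzRingType)
    (f : {rmorphism A -> B}) x :
  (forall y, y \in homog true -> f y = 0) -> in_odd_ideal x -> f x = 0.
Proof.
move=> f0 /(_ _ (kernel_ideal_closed f)) ox; apply/eqP; apply: ox => y /f0 fy.
by rewrite inE fy.
Qed.

Lemma homog_odd_ideal (K : fieldType) (A : superAlgType K) (x : A) :
  x \in homog true -> in_odd_ideal x.
Proof. by move=> hx I _; apply. Qed.

(** * Dual numbers and invariant derivations *)

Section EvenAlgebra.
Variables (K : fieldType) (B : comAlgType K).

(** A commutative algebra seen as a purely even superalgebra. *)
Definition evenAlg : Type := B.
HB.instance Definition _ := GRing.ComAlgebra.copy evenAlg B.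

Definition even_homog (i : bool) : {pred evenAlg} := [pred x | i ==> (x == 0)].

Fact even_homog_submod i : submod_closed (even_homog i).
Proof.
split=> [|a x y]; rewrite !inE ?eqxx ?implybT //.
by case: i => //= /eqP -> /eqP ->; rewrite scaler0 addr0.
Qed.

Fact even_homog_disjoint x :
  x \in even_homog false -> x \in even_homog true -> x = 0.
Proof. by move=> _; rewrite inE => /eqP. Qed.

Fact even_homog_split x : exists x0 x1,
  [/\ x0 \in even_homog false, x1 \in even_homog true & x = x0 + x1].
Proof. by exists x, 0; rewrite !inE eqxx addr0. Qed.

Fact even_homog1 : 1 \in even_homog false.
Proof. by []. Qed.

Fact even_homogM i j x y : x \in even_homog i -> y \in even_homog j ->
  x * y \in even_homog (i (+) j).
Proof.
rewrite !inE; case: i => [/eqP->|_]; first by rewrite mul0r eqxx implybT.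
by case: j => // /eqP->; rewrite mulr0 eqxx implybT.
Qed.

Fact even_supercomm i j x y : x \in even_homog i -> y \in even_homog j ->
  x * y = (-1) ^+ (i && j) * (y * x).
Proof.
rewrite !inE; case: i => [/eqP->|_]; first by rewrite mul0r mulr0 mulr0.
by rewrite mul1r mulrC.
Qed.

HB.instance Definition _ := isSuperAlgebra.Build K evenAlg
  even_homog_submod even_homog_disjoint even_homog_split
  even_homog1 even_homogM even_supercomm.

Fact even_hom_subproof (H : superAlgType K) (f : {lrmorphism H -> B}) :
  (forall x, x \in homog true -> f x = 0) ->
  forall i x, x \in homog i -> (f : {lrmorphism H -> evenAlg}) x \in homog i.
Proof. by move=> f0 [] x // /f0 fx; rewrite inE /= fx. Qed.

End EvenAlgebra.

Definition even_map (K : fieldType) (B C : comAlgType K) (f : {lrmorphism B -> C}) :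
  {superhom evenAlg B -> evenAlg C}.
Proof.
refine (@SuperHom K (evenAlg B) (evenAlg C) f _).
by move=> [] x //; rewrite !inE => /eqP ->; rewrite /= rmorph0.
Defined.

Section DualNumbers.
Variables (K : fieldType) (B : comAlgType K).

(** The dual numbers [B[t]/(t^2)]; the pair [(x, y)] stands for [x + y t]. *)
Definition dual : Type := (B * B)%type.
HB.instance Definition _ := GRing.Lmodule.copy dual (B * B)%type.

Definition dual_one : dual := (1, 0).
Definition dual_mul (x y : dual) : dual := (x.1 * y.1, x.1 * y.2 + x.2 * y.1).

Fact dual_mulA : associative dual_mul.
Proof. by move=> x y z; congr (_, _); rewrite /=; ring. Qed.
Fact dual_mulC : commutative dual_mul.
Proof. by move=> x y; congr (_, _); rewrite /=; ring. Qed.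
Fact dual_mul1 : left_id dual_one dual_mul.
Proof. by move=> [x y]; congr (_, _); rewrite /=; ring. Qed.
Fact dual_mulDl : left_distributive dual_mul +%R.
Proof. by move=> x y z; congr (_, _); rewrite /=; ring. Qed.
Fact dual_one_neq0 : dual_one != 0.
Proof. by rewrite xpair_eqE oner_eq0. Qed.

HB.instance Definition _ := GRing.Zmodule_isComNzRing.Build dual
  dual_mulA dual_mulC dual_mul1 dual_mulDl dual_one_neq0.

Fact dual_scaleAl (k : K) (x y : dual) : k *: (x * y : dual) = (k *: x : dual) * y.
Proof.
case: x y => [a b] [c d]; apply: (congr2 pair) => /=.
  exact: scalerAl.
change (k *: (a * d + b * c) = k *: a * d + k *: b * c).
by rewrite scalerDr -!scalerAl.
Qed.

HB.instance Definition _ := GRing.Lmodule_isLalgebra.Build K dual dual_scaleAl.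
HB.instance Definition _ := GRing.Lalgebra_isComAlgebra.Build K dual.

End DualNumbers.

Section DualMorphisms.
Variables (K : fieldType) (O B : comAlgType K).

Definition dual_fst : {lrmorphism dual B -> B} :=
  sval (@lrmorphism_of K (dual B) B fst (fun _ _ _ => erefl) erefl
    (fun _ _ => erefl)).

Lemma dual_fstE x : dual_fst x = x.1.
Proof. exact: (svalP (@lrmorphism_of K (dual B) B fst _ _ _)). Qed.

(** A tangent vector [g] at the [B]-point [f] is the same as the point [f + g t] over
the dual numbers. *)
Lemma lrmorphism_dual (f : {lrmorphism O -> B}) (g : O -> B) :
    linear g -> (forall x y, g (x * y) = f x * g y + g x * f y) ->
  {F : {lrmorphism O -> dual B} | forall x, F x = (f x, g x)}.
Proof.
move=> gL gM; have g1 : g 1 = 0.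
  apply: (addrI (g 1)).
  by rewrite addr0 -{3}[1]mulr1 gM rmorph1 mul1r mulr1.
apply: (@lrmorphism_of K O (dual B) (fun x => (f x, g x))).
- by move=> k x y; rewrite linearP gL.
- by rewrite rmorph1 g1.
- by move=> x y; rewrite rmorphM gM.
Qed.

End DualMorphisms.

Section GroupMorphisms.
Variables (G H : groupType) (f : {multiplicative G -> H}).

Lemma group_morphism1 : f 1%g = 1%g.
Proof. by apply: (mulgI (f 1%g)); rewrite -gmulfM !mulg1. Qed.

Lemma group_morphismV x : f (x^-1)%g = (f x)^-1%g.
Proof. by apply: (mulgI (f x)); rewrite -gmulfM !mulgV group_morphism1. Qed.

End GroupMorphisms.

Section CartierLift.
Variables (K : fieldType) (H : superAlgType K) (F : supergroupFunctor K).
Variable toF : forall B, {superhom H -> B} -> F B.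
Hypothesis toF_natural : forall B C (h : {superhom B -> C}) (x : {superhom H -> B}),
  toF (h \oS x) = sgf_map F h (toF x).
Hypothesis toF_bij : forall B, bijective (@toF B).
Variables (O : comAlgType K) (q : {lrmorphism H -> O}).
Hypothesis q_surj : forall y, exists x, q x = y.
Hypothesis q_ker : forall x, q x = 0 <-> in_odd_ideal x.

Lemma q_odd x : x \in homog true -> q x = 0.
Proof. by move=> hx; apply/q_ker; apply: homog_odd_ideal. Qed.

Fact even_point_subproof (B : comAlgType K) (f : {lrmorphism O -> B}) x :
  x \in homog true -> (f \o q : {lrmorphism H -> B}) x = 0.
Proof. by move=> hx; rewrite /= q_odd // rmorph0. Qed.

Definition even_point (B : comAlgType K) (f : {lrmorphism O -> B}) :
  {superhom H -> evenAlg B} := SuperHom (even_hom_subproof (@even_point_subproof B f)).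

(** The points of [H] in a purely even algebra factor through [O], the quotient of [H]
by its odd ideal. *)
Lemma even_pointP (B : comAlgType K) (g : {superhom H -> evenAlg B}) :
  exists f : {lrmorphism O -> B}, g = even_point f.
Proof.
have g_ker x : q x = 0 -> g x = 0.
  move=> /q_ker; apply: in_odd_ideal_kernel => y /(superhom_homog g).
  by rewrite inE => /eqP.
have /choice[s sP] := q_surj.
have gs x y : q x = y -> g (s y) = g x.
  move=> xy; apply/eqP; rewrite -subr_eq0 -rmorphB; apply/eqP/g_ker.
  by rewrite rmorphB /= sP xy subrr.
have [|||f fE] := @lrmorphism_of K O B (fun y => g (s y)).
- move=> k x y; rewrite -linearP; apply: gs.
  by rewrite linearP /= !sP.
- by rewrite (gs 1) ?rmorph1.
- by move=> x y; rewrite -rmorphM; apply: gs; rewrite rmorphM /= !sP.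
by exists f; apply: superhomP => x /=; rewrite fE (gs x).
Qed.

Lemma even_point_map (B C : comAlgType K) (f : {lrmorphism O -> B})
    (h : {lrmorphism B -> C}) (g : {lrmorphism O -> C}) :
  (forall x, h (f x) = g x) -> even_map h \oS even_point f = even_point g.
Proof. by move=> hfg; apply: superhomP => x /=; apply: hfg. Qed.

(** Write [P] and [V] for the points [p] and [p + w t] of the group, and let [gam] be the
universal even point, with values in [O]. The point [gam * (P^-1 * V)] over the
dual numbers of [O] reduces to [gam] at [t = 0], as [V] reduces to [P]; it is
therefore [x + D x t] for a derivation [D] of [O]. Specializing [O] along [p] turns
[gam] into [P], hence the product into [V], which says that [p (D x) = w x]. *)
Theorem lift_point_derivation (p : {lrmorphism O -> K^o}) w :
  point_derivation p w -> exists2 D, derivation D & forall x, p (D x) = w x.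
Proof.
move=> [wL wM].
have toF_inj B := bij_inj (@toF_bij B).
have Fcomp B C E (g : {superhom C -> E}) (f : {superhom B -> C}) (x : F B) :
    sgf_map F g (sgf_map F f x) = sgf_map F (g \oS f) x by rewrite sgf_map_comp.
pose Ko : comAlgType K := K^o.
have zeroP (B C : comAlgType K) (f : {lrmorphism B -> C}) :
    linear (fun _ : B => 0 : C) /\ forall x y : B, (0 : C) = f x * 0 + 0 * f y.
  by split=> [k x y|x y]; rewrite ?(scaler0, mulr0, mul0r, addr0).
(* [iO] and [iK] include the constants in the dual numbers; [sc] and [pt]
   extend to dual numbers the inclusion of [K] in [O] and [p]. *)
have [iO iOE] : {F : {lrmorphism O -> dual O} | forall x, F x = (x, 0)}.
  by have [hL hM] := zeroP _ _ (idfun : {lrmorphism O -> O});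
     exact: (lrmorphism_dual hL hM).
have [iK iKE] : {F : {lrmorphism Ko -> dual Ko} | forall x, F x = (x, 0)}.
  by have [hL hM] := zeroP _ _ (idfun : {lrmorphism Ko -> Ko});
     exact: (lrmorphism_dual hL hM).
have dmap (B C : comAlgType K) (f : {lrmorphism B -> C}) :
    {F : {lrmorphism dual B -> dual C} | forall x, F x = (f x.1, f x.2)}.
  have [|||G GE] := @lrmorphism_of K (dual B) (dual C) (fun x => (f x.1, f x.2)).
  - by move=> k x y; rewrite /= !linearP.
  - by rewrite /= rmorph1 rmorph0.
  - by move=> x y; rewrite /= !rmorphM rmorphD !rmorphM.
  by exists G.
have [sc0 sc0E] : {s : {lrmorphism Ko -> O} | forall k : K, s k = k%:A}.
  have [|||G GE] := @lrmorphism_of K Ko O (fun k : K => k%:A).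
  - by move=> k x y; rewrite scalerDl scalerA.
  - by rewrite scale1r.
  - by move=> x y; rewrite -scalerAl mul1r scalerA.
  by exists G.
have [sc scE] := dmap _ _ sc0.
have [pt ptE] := dmap _ _ p.
have [W WE] := lrmorphism_dual wL wM.
pose gam := toF (even_point (idfun : {lrmorphism O -> O})).
pose P := toF (even_point p).
pose V := toF (even_point W).
pose U := ((sgf_map F (even_map iK) P)^-1 * V)%g.
pose Gam := (sgf_map F (even_map iO) gam * sgf_map F (even_map sc) U)%g.
have [toG _ toGK] := toF_bij (evenAlg (dual O)).
have [f fE] := even_pointP (toG Gam).
have toFf : toF (even_point f) = Gam by rewrite -fE toGK.
have VP : sgf_map F (even_map (dual_fst Ko)) V = P.
  rewrite -toF_natural; congr toF; apply: even_point_map => x.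
  by rewrite WE dual_fstE.
have U1 : sgf_map F (even_map (dual_fst Ko)) U = 1%g.
  rewrite gmulfM group_morphismV VP Fcomp.
  rewrite (_ : _ \oS _ = superhom_id _) ?sgf_map_id ?mulVg //.
  by apply: superhomP => x /=; rewrite iKE dual_fstE.
have f1 x : (f x).1 = x.
  have : even_map (dual_fst O) \oS even_point f = even_point (idfun : {lrmorphism O -> O}).
    apply: toF_inj; rewrite toF_natural toFf gmulfM !Fcomp.
    rewrite (_ : _ \oS even_map iO = superhom_id _); last first.
      by apply: superhomP => y /=; rewrite iOE dual_fstE.
    rewrite (_ : _ \oS even_map sc = even_map sc0 \oS even_map (dual_fst Ko)); last first.
      by apply: superhomP => y /=; rewrite scE !dual_fstE.
    by rewrite sgf_map_id -Fcomp U1 group_morphism1 mulg1.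
  have [y <-] := q_surj x.
  by move=> /(congr1 (fun g : {superhom H -> evenAlg O} => g y)) /=; rewrite dual_fstE.
have f2 x : p (f x).2 = w x.
  have : even_map pt \oS even_point f = even_point W.
    apply: toF_inj; rewrite toF_natural toFf gmulfM !Fcomp.
    rewrite (_ : _ \oS even_map iO = even_map iK \oS even_map p); last first.
      by apply: superhomP => y /=; rewrite iOE iKE ptE /= rmorph0.
    rewrite (_ : _ \oS even_map sc = superhom_id _); last first.
      apply: superhomP => y /=; rewrite scE ptE /= !sc0E !linearZ !rmorph1.
      by case: y => a b; congr (_, _); apply: mulr1.
    rewrite sgf_map_id -Fcomp -toF_natural.
    rewrite (even_point_map (g := p)) // -/P /U mulVKg //.
  have [y <-] := q_surj x.
  by move=> /(congr1 (fun g : {superhom H -> evenAlg (dual Ko)} => g y)) /=; rewrite ptE WE => -[].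
exists (fun x => (f x).2) => //; split=> x y; first by rewrite rmorphD.
by rewrite rmorphM /= !f1.
Qed.

End CartierLift.

(** * From a representing superalgebra to an affine supergroup *)

(** Modulo the odd ideal every element equals its even part, and even elements
commute. *)
Lemma bosonic_quotient (K : fieldType) (H : superAlgType K) :
    ~ in_odd_ideal (1 : H) ->
  exists (O : comAlgType K) (q : {lrmorphism H -> O}),
    (forall y, exists x, q x = y) /\ (forall x, q x = 0 <-> in_odd_ideal x).
Proof.
move=> odd1; pose J : {pred H} := [pred x | `[< in_odd_ideal x >] ].
have JP x : x \in J <-> in_odd_ideal x.
  by rewrite inE; split=> [/asboolP|Jx] //; apply/asboolP.
have Jid : ideal_closed J.
  split=> [|x y /JP Jx /JP Jy|a x /JP Jx|a x /JP Jx]; apply/JP => I II oI;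
    case: (II) => I0 ID IM IMr => //.
  - by apply: ID; [apply: Jx|apply: Jy].
  - by apply: IM; apply: Jx.
  - by apply: IMr; apply: Jx.
have J1 : 1 \notin J by apply/negP => /JP.
have Jodd x : x \in homog true -> x \in J.
  by move=> hx; apply/JP; apply: homog_odd_ideal.
pose I := MakeProperIdeal Jid J1.
have [|O [q [q_surj q_ker]]] := @commutative_quotient K H I.
  have evenpart x : exists2 x0, x0 \in homog false & quotient_pi I x = quotient_pi I x0.
    have [x0 [x1 [hx0 hx1 ->]]] := homog_split x; exists x0 => //.
    by apply/quotient_piP; rewrite addrC addKr; apply: Jodd.
  move=> x y; apply/quotient_piP; rewrite !rmorphM /=.
  have [[x0 hx ->] [y0 hy ->]] := conj (evenpart x) (evenpart y).
  by rewrite -!rmorphM (supercomm _ _ _ _ hx hy) mul1r.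
by exists O, q; split=> // x; rewrite q_ker; apply: JP.
Qed.

(** A quotient of [A] that kills the odd elements is a quotient of the coordinate
ring of the underlying ordinary variety of [A]. *)
Lemma finitely_generated_quotient (K : fieldType) (A : superAlgType K)
    (O : comAlgType K) (q : {lrmorphism A -> O}) :
    bosonic_quotient_affine A -> (forall y, exists x, q x = y) ->
    (forall x, x \in homog true -> q x = 0) ->
  finitely_generated_algebra O.
Proof.
move=> [OA [piA [piA_surj piA_ker [/finitely_generatedP[n [g gP]] _]]]] q_surj q_odd.
have /choice[s sP] := fun i => piA_surj (g i).
apply/finitely_generatedP; exists n, (fun i => q (s i)) => P [PA PD PM] Pg y.
have piA_q x x' : piA x = piA x' -> q x = q x'.
  move=> xx'; apply/eqP; rewrite -subr_eq0 -rmorphB; apply/eqP.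
  by apply: in_odd_ideal_kernel => //; apply/piA_ker; rewrite rmorphB /= xx' subrr.
have [x <-] := q_surj y.
have [x' xx' Px'] : exists2 x', piA x' = piA x & P (q x').
  move: (piA x); apply: gP => [|i]; last by exists (s i); [apply: sP|apply: Pg].
  split=> [k|_ _ [t <- Pt] [t' <- Pt']|_ _ [t <- Pt] [t' <- Pt']].
  - by exists k%:A; rewrite linearZ rmorph1 //; apply: PA.
  - by exists (t + t'); rewrite rmorphD //; apply: PD.
  - by exists (t * t'); rewrite rmorphM //; apply: PM.
by rewrite -(piA_q _ _ xx').
Qed.

Lemma odd_part_finite_quotient (K : fieldType) (A H : superAlgType K)
    (q : {superhom A -> H}) :
  homog_surjective q -> odd_part_finite A -> odd_part_finite H.
Proof.
move=> q_homog [n [g [g_odd gP]]]; exists n, (fun i => q (g i)); split=> [i|y].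
  exact: superhom_homog.
move=> /q_homog[x /gP[c [c_even ->]] <-]; exists (fun i => q (c i)); split=> [i|].
  exact: superhom_homog.
by rewrite rmorph_sum; apply: eq_bigr => i _; rewrite rmorphM.
Qed.

(** The element [xi] of [F H] is the universal point, in the sense of Yoneda's lemma: the
points of [H] in [B] correspond to the elements of [F B], and the group law is transported
along this bijection. That the underlying variety is reduced is Cartier's theorem. *)
Theorem affine_supergroup_of_functor (K : closedFieldType) (H : superAlgType K)
    (F : supergroupFunctor K) (xi : F H) :
    [pchar K] =i pred0 -> ~ countable [set: K]%classic ->
    (forall B, bijective (fun f : {superhom H -> B} => sgf_map F f xi)) ->
    odd_part_finite H ->
    (forall (O : comAlgType K) (q : {lrmorphism H -> O}),
      (forall y, exists x, q x = y) -> (forall x, x \in homog true -> q x = 0) ->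
      finitely_generated_algebra O) ->
  representable_by_affine_supergroup F.
Proof.
move=> charK uncK; set toF := (fun B (f : {superhom H -> B}) => sgf_map F f xi).
move=> bijF oddH fgH.
have toF_natural B C (h : {superhom B -> C}) (x : {superhom H -> B}) :
    toF C (h \oS x) = sgf_map F h (toF B x) by exact: sgf_map_comp.
have exF B : exists g : F B -> {superhom H -> B},
    cancel (toF B) g /\ cancel g (toF B).
  by case: (bijF B) => g ? ?; exists g.
pose fromF B := projT1 (cid (exF B)).
have toFK B : cancel (toF B) (fromF B) := (projT2 (cid (exF B))).1.
have fromFK B : cancel (fromF B) (toF B) := (projT2 (cid (exF B))).2.
have [O [q [q_surj q_ker]]] : exists (O : comAlgType K) (q : {lrmorphism H -> O}),
    (forall y, exists x, q x = y) /\ (forall x, q x = 0 <-> in_odd_ideal x).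
  (* The unit of [F K] is a point of [H] in the field, and it kills the odd ideal. *)
  apply: bosonic_quotient => odd1; pose e := fromF K^o 1%g.
  have : e 1 = 0.
    by apply: in_odd_ideal_kernel => // y /(superhom_homog e); rewrite inE => /eqP.
  by rewrite rmorph1 => /eqP; rewrite oner_eq0.
have q_odd x : x \in homog true -> q x = 0.
  by move=> hx; apply/q_ker; apply: homog_odd_ideal.
have fgO := fgH O q q_surj q_odd.
have redO : reduced O.
  apply: (reduced_of_lifted_derivations charK uncK fgO) => p w.
  exact: (lift_point_derivation toF_natural bijF q_surj q_ker).
have bosH : bosonic_quotient_affine H by exists O, q.
pose V := AffineSupervariety bosH oddH.
pose mul B (x y : points V B) : points V B := fromF B (toF B x * toF B y)%g.
pose one B : points V B := fromF B 1%g.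
pose inv B (x : points V B) : points V B := fromF B (toF B x)^-1%g.
have mulA B : associative (mul B).
  by move=> x y z; rewrite /mul !fromFK mulgA.
have mul1 B : left_id (one B) (mul B).
  by move=> x; rewrite /mul /one fromFK mul1g toFK.
have mulr1 B : right_id (one B) (mul B).
  by move=> x; rewrite /mul /one fromFK mulg1 toFK.
have mulV B : left_inverse (one B) (inv B) (mul B).
  by move=> x; rewrite /mul /inv fromFK mulVg.
have mulrV B : right_inverse (one B) (inv B) (mul B).
  by move=> x; rewrite /mul /inv fromFK mulgV.
have mulN B C (h : {superhom B -> C}) (x y : points V B) :
    points_map h (mul B x y) = mul C (points_map h x) (points_map h y).
  apply: (can_inj (toFK C)); rewrite /points_map toF_natural !fromFK.
  by rewrite !toF_natural gmulfM.
pose G := AffineSupergroup mulA mul1 mulr1 mulV mulrV mulN.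
have phiM B : {morph (toF B : gpoints G B -> F B) : x y / (x * y)%g}.
  by move=> x y; apply: fromFK.
exists G.
pose phi B : {multiplicative gpoints G B -> F B} :=
  HB.pack_for {multiplicative gpoints G B -> F B} (toF B)
    (isMultiplicative.Build (gpoints G B) (F B) (toF B) (phiM B)).
by exists phi; split.
Qed.

(** * The stabilizer *)

Lemma superhom_factor (K : fieldType) (A H B : superAlgType K)
    (q : {superhom A -> H}) (g : {superhom A -> B}) :
    homog_surjective q -> (forall x, q x = 0 -> g x = 0) ->
  exists f : {superhom H -> B}, f \oS q = g.
Proof.
move=> q_homog q_g.
have gq x y : q x = q y -> g x = g y.
  move=> xy; apply/eqP; rewrite -subr_eq0 -rmorphB; apply/eqP/q_g.
  by rewrite rmorphB /= xy subrr.
have /choice[s sP] := homog_surjectiveW q_homog.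
have [|||f fE] := @lrmorphism_of K H B (fun y => g (s y)).
- by move=> k x y; rewrite -linearP; apply: gq; rewrite linearP /= !sP.
- by rewrite -(rmorph1 g); apply: gq; rewrite sP rmorph1.
- by move=> x y; rewrite -rmorphM; apply: gq; rewrite rmorphM /= !sP.
have fh i y : y \in homog i -> f y \in homog i.
  move=> /q_homog[x hx <-]; rewrite fE (gq _ x) ?sP //.
  exact: superhom_homog.
by exists (SuperHom fh); apply: superhomP => x /=; rewrite fE; apply: gq.
Qed.

Section StabilizerRepresentable.
Variables (K : fieldType) (G : affineSupergroup K) (X : affineSupervariety K).
Variables (a : action G X) (u : points X K^o).
Let A := Defs.coord G.

(** The universal point of [G] applied to [u]; [stabP] reads the equations of the
stabilizer off it. *)
Definition orbit_map : points X A := act a (superhom_id A : gpoints G A) (point_at u A).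

Lemma act_point_at B (g : gpoints G B) : act a g (point_at u B) = g \oS orbit_map.
Proof.
rewrite -[RHS]/(points_map _ _) /orbit_map act_natural point_at_map; congr act.
exact: superhomP.
Qed.

Lemma stabP B (g : gpoints G B) :
  stab a u g <-> forall x, g (orbit_map x) = (u x : K)%:A.
Proof.
rewrite /stab /= act_point_at; split=> [/eqP gu x|gu].
  by have /(congr1 (fun h : {superhom Defs.coord X -> B} => h x)) := gu.
by apply/eqP/superhomP => x /=; rewrite gu.
Qed.

(** Defined as the common kernel of all stabilizing points rather than by
generators: that it is a homogeneous ideal then follows from the same property
of each kernel, and properness from the stabilizing unit of [G]. *)
Definition stab_ideal : {pred A} := [pred x | `[< forall B (g : gpoints G B),
  stab a u g -> g x = 0 >] ].

Lemma stab_idealP x : x \in stab_ideal <->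
  forall B (g : gpoints G B), stab a u g -> g x = 0.
Proof. by rewrite inE; split=> [/asboolP|Jx] //; apply/asboolP. Qed.

Lemma stab_ideal_closed : ideal_closed stab_ideal.
Proof.
split=> [|x y /stab_idealP Jx /stab_idealP Jy|b x /stab_idealP Jx|b x /stab_idealP Jx];
  apply/stab_idealP => B g gu.
- exact: rmorph0.
- by rewrite rmorphD /= (Jx B g gu) (Jy B g gu) addr0.
- by rewrite rmorphM /= (Jx B g gu) mulr0.
- by rewrite rmorphM /= (Jx B g gu) mul0r.
Qed.

Lemma stab_ideal_proper : 1 \notin stab_ideal.
Proof.
apply/negP => /stab_idealP J1.
have [e1 _] := @stab_group_closed K G X a u K^o.
by have /eqP := J1 K^o 1%g e1; rewrite rmorph1 oner_eq0.
Qed.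

Lemma stab_universal : exists (H : superAlgType K) (q : {superhom A -> H}),
  [/\ homog_surjective q, stab a u (q : gpoints G H)
    & forall B (g : gpoints G B), stab a u g -> forall x, q x = 0 -> g x = 0].
Proof.
have [|H [q [q_homog q_ker]]] :=
    @super_quotient K A (MakeProperIdeal stab_ideal_closed stab_ideal_proper).
  move=> x0 x1 h0 h1 /stab_idealP J01.
  have Jg B (g : gpoints G B) : stab a u g -> g x0 = 0 /\ g x1 = 0.
    move=> gu; have := J01 B g gu; rewrite rmorphD /= => /eqP; rewrite addr_eq0 => /eqP g01.
    have g0 : g x0 = 0.
      apply: homog_disjoint; first exact: superhom_homog.
      by rewrite g01 -rmorphN; apply: superhom_homog; apply: homogN.
    by split=> //; move: g01; rewrite g0 => /esym/eqP; rewrite oppr_eq0 => /eqP.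
  by split; apply/stab_idealP => B g /Jg[].
exists H, q; split=> //; last by move=> B g gu x /q_ker/stab_idealP; apply.
apply/stabP => x; apply/eqP; rewrite -subr_eq0.
have -> : (u x : K)%:A = q (u x : K)%:A by rewrite linearZ rmorph1.
rewrite -rmorphB; apply/eqP/q_ker/stab_idealP => B g /stabP gu.
by rewrite rmorphB /= gu linearZ rmorph1 subrr.
Qed.

End StabilizerRepresentable.

Theorem stab_representable (K : closedFieldType) (G : affineSupergroup K)
    (X : affineSupervariety K) (a : action G X) (u : points X K^o) :
    [pchar K] =i pred0 -> ~ countable [set: K]%classic ->
  representable_by_affine_supergroup (Stab a u).
Proof.
move=> charK uncK; have [H [q [q_homog qu q_ker]]] := stab_universal a u.
have q_surj := homog_surjectiveW q_homog.
pose xi : Stab a u H := exist _ (q : gpoints G H) qu.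
apply: (@affine_supergroup_of_functor K H (Stab a u) xi) => //.
- move=> B.
  have lift (g : Stab a u B) : exists f : {superhom H -> B}, sgf_map (Stab a u) f xi = g.
    have [f fq] := superhom_factor (g := val g) q_homog (q_ker B (val g) (valP g)).
    by exists f; apply: val_inj.
  pose lft g := projT1 (cid (lift g)).
  exists lft => [f|g]; last exact: (projT2 (cid (lift g))).
  apply: superhomP => y; have [x <-] := q_surj y.
  have := projT2 (cid (lift (sgf_map (Stab a u) f xi))).
  by move=> /(congr1 val)/(congr1 (fun h : {superhom Defs.coord G -> B} => h x)).
- exact: (odd_part_finite_quotient q_homog (coord_odd G)).
- move=> O r r_surj r_odd.
  apply: (finitely_generated_quotient (q := (r \o q : {lrmorphism _ -> O}))).
  + exact: coord_bosonic.
  + by move=> y; have [x <-] := r_surj y; have [z <-] := q_surj x; exists z.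
  + by move=> x hx; apply: r_odd; apply: superhom_homog.
Qed.

(** A countable set has Lebesgue measure 0, but [[0, 1]] has measure 1. *)
Lemma uncountable_real (R : realType) : ~ countable [set: R]%classic.
Proof.
move=> cR; pose I : interval R := `[0, 1]%R.
have cI : countable [set` I]%classic.
  by apply: sub_countable cR; apply: subset_card_le.
have := lebesgue_measure_itv I; rewrite (countable_lebesgue_measure0 cI) /=.
by rewrite lte_fin Num.Theory.ltr01 oppr0 adde0 => /eqP; rewrite eq_sym onee_eq0.
Qed.

Lemma uncountable_complex (R : realType) : ~ countable [set: R[i]]%classic.
Proof.
move=> cC; apply: (@uncountable_real R).
have -> : [set: R]%classic = (@complex.Re R @` [set: R[i]])%classic.
  by apply/seteqP; split=> // x _; exists (x%:C)%C.
by apply: sub_countable cC; apply: card_image_le.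
Qed.

Theorem theorem5p2 (R : realType)
    (G : affineSupergroup R[i]) (X : affineSupervariety R[i])
    (rho : action G X) (u : points X (R[i])^o) :
  representable_by_affine_supergroup (Stab rho u).
Proof.
apply: stab_representable; last exact: uncountable_complex.
exact: Num.Theory.pchar_num.
Qed.
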